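(* Let $f:X\to X$ be a piecewise contracting interval map (PCIM), with contraction pieces $X_1,\dots,X_N$ ($N\geq 2$), which is injective on each of its contraction pieces and such that $D\subset\widetilde X$. Then there exist two natural numbers $N_1$ and $N_2$ (possibly zero) such that: 1) The attractor $\Lambda$ of $f$ can be decomposed as $$\Lambda=\left(\bigcup_{i=1}^{N_1}\mathcal O_i\right)\cup\left(\bigcup_{j=1}^{N_2}K_j\right),$$ where $\mathcal O_1,\ldots,\mathcal O_{N_1}\subset\widetilde X$ are periodic orbits and $K_1,\ldots,K_{N_2}$ are $\widetilde X$-minimal pseudo-invariant Cantor sets of $X$. 2) For any $x\in\widetilde X$, either there exists $i\in\{1,\dots,N_1\}$ such that $\omega(x)=\mathcal O_i$, or there exists $j\in\{1,\dots,N_2\}$ such that $\omega(x)=K_j$. 3) If $N_2\geq 1$, then for any $j\in\{1,\dots,N_2\}$ there exists $k\in\{1,\dots,N-1\}$ such that $c_k\in K_j$ and $K_j=\overline{\mathcal O(d_k^+)}=\overline{\mathcal O(d_k^-)}$. 4) If $N_2\geq 1$, then for any $j\in\{1,\dots,N_2\}$ and $k\in\{1,\dots,N-1\}$ such that $c_k\in K_j$, we have $K_j=\overline{\mathcal O(d_k^+)}$ or $K_j=\overline{\mathcal O(d_k^-)}$. Moreover, if $c_k\in K_j$ does not belong to the boundary of a gap of $K_j$, then $\overline{\mathcal O(d_k^+)}=\overline{\mathcal O(d_k^-)}$. 5) We have $1\leq N_1+N_2\leq \# D$ and $N_1+2N_2\leq 2(N-1)$. Moreover, if $f$ is increasing on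 each of its contraction pieces, then $N_1$ and $N_2$ also satisfy $N_1+N_2\leq N$.
   Context: Let $X=[c_0,c_N]\subset\mathbb R$ be a compact interval with nonempty interior. A map $f:X\to X$ is a piecewise contracting interval map (PCIM) if there are $\lambda\in(0,1)$, $N\geq2$ and points $c_0<c_1<\dots<c_{N-1}<c_N$ such that, with the contraction pieces $X_1=[c_0,c_1)$, $X_i=(c_{i-1},c_i)$ for $1<i<N$, $X_N=(c_{N-1},c_N]$, one has $|f(x)-f(y)|\leq\lambda|x-y|$ for all $x,y\in X_i$ and all $i\in\{1,\dots,N\}$. Put $\Delta=\{c_1,\dots,c_{N-1}\}$ (the values of $f$ on $\Delta$ are arbitrary). For each $i$, $f_i:\overline{X_i}\to X$ is the unique continuous extension of $f|_{X_i}$. Put $d_0=f_1(c_0)$, $d_N=f_N(c_N)$, and, for $1\leq i\leq N-1$, $d_i^-=f_i(c_i)$, $d_i^+=f_{i+1}(c_i)$; $D=\{d_0,d_1^-,\dots,d_{N-1}^-,d_1^+,\dots,d_{N-1}^+,d_N\}$. Put $\widetilde X=\bigcap_{n\geq0}f^{-n}(X\setminus\Delta)$. The attractor is $\Lambda=\bigcap_{n\geq1}\Lambda_n$, where $\Lambda_1=\overline{f(X\setminus\Delta)}$ and $\Lambda_{n+1}=\overline{f(\Lambda_n\setminus\Delta)}$ for $n\geq1$. $\mathcal O(x)=\{f^n(x)\}_{n\geq0}$ is the forward orbit; it is periodic if $f^p(x)=x$ for some $p\geq1$. $\omega(x)$ is the set of limits of convergent subsequences $f^{n_k}(x)$ with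 $n_k\to\infty$ strictly increasing. A set $A\subset X$ is pseudo-invariant if for every $x\in A$, $\lim_{y\to x^-}f(y)\in A$ or $\lim_{y\to x^+}f(y)\in A$ (at an endpoint of $X$ only the one-sided limit from inside $X$ is considered). A set $A\subset X$ is $\widetilde X$-minimal if $\overline{\mathcal O(x)}=A$ for every $x\in A\cap\widetilde X$. A Cantor set is a nonempty compact, perfect, totally disconnected set. A gap of a Cantor set $K\subset X$ is a connected component of $X\setminus K$. *)

(* Defs.v *)
From HB Require Import structures.
From mathcomp Require Import all_boot all_order all_algebra finmap.
From mathcomp Require Import all_classical all_reals all_analysis.
From mathcomp Require Import lra.

Set Implicit Arguments.
Unset Strict Implicit.
Unset Printing Implicit Defensive.

Import Order.TTheory GRing.Theory Num.Theory.
Import numFieldNormedType.Exports.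

Local Open Scope classical_set_scope.
Local Open Scope ring_scope.

(* The maps are total functions on R; only their values on the interval
   [c 0, c N] matter. Likewise, only c 0, ..., c N matter in c : nat -> R. *)

Definition space (R : realType) (N : nat) (c : nat -> R) : set R :=
  [set` `[c 0%N, c N]].

(* X_1 contains its left endpoint and X_N its right endpoint; all the other
   ends are open. The index i ranges over 1, ..., N. *)
Definition piece (R : realType) (N : nat) (c : nat -> R) (i : nat) : set R :=
  [set` Interval (if i == 1%N then BLeft (c i.-1) else BRight (c i.-1))
                 (if i == N then BRight (c i) else BLeft (c i))].

Definition discont (R : realType) (N : nat) (c : nat -> R) : set R :=
  c @` [set k | (0 < k < N)%N].

Definition pcim (R : realType) (N : nat) (c : nat -> R) (f : R -> R) : Prop :=
  [/\ (2 <= N)%N,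
      forall i, (i < N)%N -> c i < c i.+1,
      set_fun (space N c) (space N c) f &
      exists2 lambda : R, 0 < lambda < 1 &
        forall i, (0 < i <= N)%N -> lambda.-lipschitz_(piece N c i) f].

(* f_i, the continuous extension of f from X_i to its closure, obtained as a
   limit along X_i; see piece_extP below. *)
Definition piece_ext (R : realType) (N : nat) (c : nat -> R) (f : R -> R)
    (i : nat) (x : R) : R :=
  lim (f y @[y --> within (piece N c i) (nbhs x)]).

Lemma piece_lip (R : realType) (N : nat) (c : nat -> R) (f : R -> R)
    (i : nat) (x y : R) :
  pcim N c f -> (0 < i <= N)%N -> piece N c i x -> piece N c i y ->
  `|f x - f y| <= `|x - y|.
Proof.
move=> [_ _ _ [l /andP[l0 l1] lipf]] iN Px Py.
apply: le_trans (lipf _ iN (x, y) (conj Px Py)) _ => /=.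
by rewrite ler_piMl// ltW.
Qed.

Lemma piece_ext_cvg (R : realType) (N : nat) (c : nat -> R) (f : R -> R)
    (i : nat) (x : R) :
  pcim N c f -> (0 < i <= N)%N -> closure (piece N c i) x ->
  f y @[y --> within (piece N c i) (nbhs x)] --> piece_ext N c f i x.
Proof.
move=> fP iN clx; pose F := within (piece N c i) (nbhs x).
have FF : ProperFilter F by exact: within_nbhs_proper.
apply/cauchy_cvgP/cauchy_exP => _/posnumP[d].
have d2 : 0 < d%:num / 2 by [].
have [y0 [Py0]] := clx _ (nbhsx_ballx x _ d2).
rewrite -ball_normE /= => xy0.
exists (f y0); rewrite /= /F /within /=.
apply: filterS (nbhsx_ballx x _ d2) => y; rewrite -!ball_normE /= => xy Py.
apply: le_lt_trans (piece_lip fP iN Py0 Py) _.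
rewrite -(subrKA x) [d%:num]splitr.
by apply: le_lt_trans (ler_normD _ _) _; rewrite ltrD// distrC.
Qed.

Lemma piece_ext_approx (R : realType) (N : nat) (c : nat -> R) (f : R -> R)
    (i : nat) (x e : R) :
  pcim N c f -> (0 < i <= N)%N -> closure (piece N c i) x -> 0 < e ->
  exists2 y, piece N c i y & `|x - y| < e /\ `|piece_ext N c f i x - f y| < e.
Proof.
move=> fP iN clx e0.
have FF : ProperFilter (within (piece N c i) (nbhs x)).
  exact: within_nbhs_proper.
have /cvgrPdist_lt/(_ _ e0) near1 := piece_ext_cvg fP iN clx.
have near2 : \forall y \near within (piece N c i) (nbhs x), `|x - y| < e.
  have := nbhsx_ballx x _ e0.
  by rewrite -ball_normE; apply: (@cvg_within _ (nbhs x)).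
have near3 : within (piece N c i) (nbhs x) (piece N c i) by exact: withinT.
have [y [? [? ?]]] := filter_ex (filterI near3 (filterI near2 near1)).
by exists y.
Qed.

Lemma piece_extP (R : realType) (N : nat) (c : nat -> R) (f : R -> R)
    (i : nat) :
  pcim N c f -> (0 < i <= N)%N ->
  {within closure (piece N c i), continuous (piece_ext N c f i)} /\
  {in piece N c i, piece_ext N c f i =1 f}.
Proof.
move=> fP iN; split.
  apply/subspace_continuousP => x clx; apply/cvgrPdist_lt => e e0.
  have e5 : 0 < e / 5 by rewrite divr_gt0.
  rewrite near_withinE; apply: filterS (nbhsx_ballx x _ e5) => y.
  rewrite -ball_normE /= => xy cly.
  have [x' Px' [xx' fx']] := piece_ext_approx fP iN clx e5.
  have [y' Py' [yy' fy']] := piece_ext_approx fP iN cly e5.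
  have := piece_lip fP iN Px' Py'.
  have H1 := ler_distD x x' y'.
  have H2 := ler_distD y x y'.
  have H3 := ler_distD (f x') (piece_ext N c f i x) (piece_ext N c f i y).
  have H4 := ler_distD (f y') (f x') (piece_ext N c f i y).
  move: H1 H4; rewrite (distrC x' x) (distrC (f y') (piece_ext _ _ _ _ _)); lra.
move=> x; rewrite inE => Px; apply/eqP; rewrite -subr_eq0 -normr_eq0.
rewrite -normr_le0; apply/ler_addgt0Pr => e e0; rewrite normr_id add0r.
have e2 : 0 < e / 2 by rewrite divr_gt0.
have [y Py [xy fy]] := piece_ext_approx fP iN (subset_closure Px) e2.
have := piece_lip fP iN Px Py.
have := ler_distD (f y) (piece_ext N c f i x) (f x).
rewrite (distrC (f y) (f x)); lra.
Qed.

Definition d_first (R : realType) (N : nat) (c : nat -> R) (f : R -> R) : R :=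
  piece_ext N c f 1 (c 0%N).

Definition d_last (R : realType) (N : nat) (c : nat -> R) (f : R -> R) : R :=
  piece_ext N c f N (c N).

Definition d_minus (R : realType) (N : nat) (c : nat -> R) (f : R -> R)
    (k : nat) : R :=
  piece_ext N c f k (c k).

Definition d_plus (R : realType) (N : nat) (c : nat -> R) (f : R -> R)
    (k : nat) : R :=
  piece_ext N c f k.+1 (c k).

Definition dset (R : realType) (N : nat) (c : nat -> R) (f : R -> R) : set R :=
  [set d_first N c f; d_last N c f]
  `|` d_minus N c f @` [set k | (0 < k < N)%N]
  `|` d_plus N c f @` [set k | (0 < k < N)%N].

Definition tspace (R : realType) (N : nat) (c : nat -> R) (f : R -> R) : set R :=
  [set x | space N c x /\
           forall n, (space N c `\` discont N c) (iter n f x)].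

(* With Lambda_0 := X, the recursion also produces Lambda_1. *)
Definition attractor_step (R : realType) (N : nat) (c : nat -> R) (f : R -> R)
    (n : nat) : set R :=
  iter n (fun A => closure (f @` (A `\` discont N c))) (space N c).

Definition attractor (R : realType) (N : nat) (c : nat -> R) (f : R -> R) :
    set R :=
  \bigcap_(n in [set n | (1 <= n)%N]) attractor_step N c f n.

Definition forward_orbit (R : realType) (f : R -> R) (x : R) : set R :=
  range (fun n => iter n f x).

Definition periodic_orbit (R : realType) (N : nat) (c : nat -> R) (f : R -> R)
    (A : set R) : Prop :=
  exists x, [/\ space N c x, (exists2 p, (1 <= p)%N & iter p f x = x) &
                A = forward_orbit f x].

Definition omega_limit (R : realType) (f : R -> R) (x : R) : set R :=
  [set y | exists2 s : nat -> nat, {homo s : m n / (m < n)%N} &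
             iter (s k) f x @[k --> \oo] --> y].

Definition pseudo_invariant (R : realType) (N : nat) (c : nat -> R)
    (f : R -> R) (A : set R) : Prop :=
  A `<=` space N c /\
  forall x, A x ->
    (c 0%N < x /\ exists2 l, A l & f y @[y --> x^'-] --> l) \/
    (x < c N /\ exists2 l, A l & f y @[y --> x^'+] --> l).

Definition tminimal (R : realType) (N : nat) (c : nat -> R) (f : R -> R)
    (A : set R) : Prop :=
  A `<=` space N c /\
  forall x, (A `&` tspace N c f) x -> closure (forward_orbit f x) = A.

Definition cantor_set (R : realType) (A : set R) : Prop :=
  [/\ A !=set0, compact A, perfect_set A & totally_disconnected A].

Definition gap (R : realType) (N : nat) (c : nat -> R) (K G : set R) : Prop :=
  exists2 x, (space N c `\` K) x & G = connected_component (space N c `\` K) x.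

Definition boundary (R : realType) (A : set R) : set R :=
  closure A `\` interior A.

(* Main.v *)
Require Import Defs.
From mathcomp Require Import all_boot all_order all_algebra finmap.
From mathcomp Require Import all_classical all_reals all_analysis.
From mathcomp Require Import ring lra zify.

Set Implicit Arguments.
Unset Strict Implicit.
Unset Printing Implicit Defensive.

Import Order.TTheory GRing.Theory Num.Theory.
Import numFieldNormedType.Exports.

Local Open Scope classical_set_scope.
Local Open Scope ring_scope.

(** The values of [f] at a point near a discontinuity [c k] are close to one of the
    two one-sided values [d_plus k] and [d_minus k], and these are points whose
    orbits never meet the discontinuities. The whole structure is read off from
    the sides of discontinuities that an orbit approaches, that is, enters
    arbitrarily deeply at arbitrarily late times.

    If the orbit of [x] approaches none of them, it stays at a positive distance
    from the discontinuities. Two of its points that are closer together than this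
    distance are contracted towards each other for ever, so the orbit converges to
    a cycle ([regular_periodic]).

    Otherwise it approaches some side [s] of some [c k], and the central fact is
    that its limit set is the closure of the orbit of the one-sided value
    [d = dval k s], whichever side is chosen ([omega_limit_germ]). Continuity gives
    one inclusion. For the other, let [A] be this closure. As [A] is closed and
    invariant, there is a scale [eta] below which [A] enters only those sides whose
    one-sided values lie in [A]. If a point lies between two points of [A] less than
    [eta] apart and a discontinuity falls in between, then [A] enters both of its
    sides below that scale, so the image of the point lies again between two points
    of [A], with a contracted distance ([omega_limit_sandwich]). The orbit of [x] gets
    into such a position by comparing two visits to the side [s] of [c k]: the first
    one is followed until a discontinuity separates it from the orbit of [d], and a
    second, much deeper visit arrives at the same time between the orbit of [d] and
    that discontinuity ([omega_limit_capture]).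

    Since this holds for every approached side, minimality follows at once
    ([omega_limit_minimal]). The limit set is perfect because the orbit of [d] never
    repeats, and totally disconnected because the [n]-th approximation of the
    attractor is covered by segments whose total length decays geometrically. Some
    discontinuity is approached from both sides, since otherwise two visits to the
    same side would never be separated and the limit set would be finite
    ([exists_two_sided]).

    Injectivity makes the branches strictly monotone. An enclosure of an orbit by
    two companions is then mapped to an enclosure with distinct ends, where a
    companion cut off by a discontinuity is replaced by a one-sided value
    ([follow]). Started from the two ends of the space, such enclosures show that
    each point of the attractor is a limit point of the orbit of a point of [dset]
    ([attractor_sub]): the enclosures shrink and two early iterates are far apart,
    so one of the ends is a late iterate. Started from one companion only, they show
    that each attracting cycle attracts a one-sided value ([regular_germ]), which can
    be taken on the right-hand side, or at the left end of the space, when the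
    branches increase ([regular_left_germ]). All limit sets are therefore limit sets
    of the [2 * (N - 1)] one-sided values, cycles being attained at least once and
    Cantor sets at least twice; this gives the bounds on their numbers. *)

(** * Betweenness and clamping *)

Definition between (R : realType) (u x v : R) : Prop :=
  (u <= x <= v) \/ (v <= x <= u).

Lemma between_sym (R : realType) (u x v : R) : between u x v -> between v x u.
Proof. by case; [right|left]. Qed.

Lemma sign_between (R : realType) (s u x v : R) : `|s| = 1 ->
  s * u <= s * x -> s * x <= s * v -> between u x v.
Proof.
move=> s1 h1 h2; case: (ger0P s) s1 => _ s1; [left|right].
  by move: h1 h2; rewrite s1 !mul1r => -> ->.
have e : s = -1 by rewrite -s1 opprK.
by move: h1 h2; rewrite e !mulN1r !lerN2 => -> ->.
Qed.

(** Nearest point of the segment from [a] to [b]: composed with the extension of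
    [f] to a closed piece, it yields a map of the whole line. *)
Definition clamp (R : realType) (a b u : R) : R := Num.max a (Num.min b u).

Lemma clampP (R : realType) (a b u : R) : a <= b ->
  [\/ u <= a /\ clamp a b u = a, a <= u <= b /\ clamp a b u = u |
      b <= u /\ clamp a b u = b].
Proof.
move=> ab; rewrite /clamp; case: (leP b u) => bu.
  by apply: Or33; split => //; apply/max_idPr.
case: (leP u a) => ua; first by apply: Or31.
by apply: Or32; rewrite !ltW.
Qed.

Lemma clamp_le (R : realType) (a b u v : R) : a <= b -> u <= v ->
  clamp a b u <= clamp a b v.
Proof.
by move=> ab uv; case: (clampP u ab) => -[h ->]; case: (clampP v ab) => -[h' ->]; lra.
Qed.

Lemma clampK (R : realType) (a b u : R) : a <= b ->
  clamp a b (clamp a b u) = clamp a b u.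
Proof.
move=> ab; case: (clampP u ab) => -[h E]; rewrite E //.
- by case: (clampP a ab) => -[h' ->] //; lra.
- by case: (clampP b ab) => -[h' ->] //; lra.
Qed.

Lemma clamp_eq (R : realType) (a b u v : R) : a < b -> clamp a b u = clamp a b v ->
  [\/ u = v, u <= a /\ v <= a | b <= u /\ b <= v].
Proof.
move=> ab; case: (clampP u (ltW ab)) => -[hu ->]; case: (clampP v (ltW ab)) => -[hv ->];
  move=> E; try lra.
- by apply: Or32.
- by apply: Or32; lra.
- by apply: Or32; lra.
- by apply: Or31.
- by apply: Or33; lra.
- by apply: Or33; lra.
- by apply: Or33.
Qed.

(** * Uniform choices over finitely many conditions *)

(** Positive thresholds and starting times that exist for each of finitely many
    conditions can be replaced by common ones; this is how every choice over
    all discontinuities is made uniform. *)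
Lemma uniform_pos (R : realType) (P : nat -> R -> nat -> Prop) (K : nat) :
  (forall k e n e' n', P k e n -> 0 < e' -> e' <= e -> (n <= n')%N -> P k e' n') ->
  (forall k, (k < K)%N -> exists e n, 0 < e /\ P k e n) ->
  exists e n, 0 < e /\ forall k, (k < K)%N -> P k e n.
Proof.
move=> mono; elim: K => [|K IH] H; first by exists 1, 0%N.
have [e [n [e0 P1]]] := IH (fun k kK => H k (ltnW kK)).
have [e' [n' [e'0 P2]]] := H K (ltnSn K).
have m0 : 0 < Num.min e e' by rewrite lt_min e0.
exists (Num.min e e'), (maxn n n'); split => // k; rewrite ltnS leq_eqVlt.
case/predU1P => [->|kK].
  by apply: mono P2 _ _ _; rewrite ?ge_min ?lexx ?orbT ?leq_maxr.
by apply: mono (P1 k kK) _ _ _; rewrite ?ge_min ?lexx ?leq_maxl.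
Qed.

Lemma finite_far (R : realType) (P : pred nat) (u : nat -> R) (y : R) (K : nat) :
  (forall k, (k < K)%N -> P k -> u k <> y) ->
  exists2 e, 0 < e & forall k, (k < K)%N -> P k -> e <= `|u k - y|.
Proof.
move=> H; have := @uniform_pos R (fun k e _ => P k -> e <= `|u k - y|) K.
case.
- by move=> k e n e' n' h _ ee _ /h; exact: le_trans.
- move=> k kK; case Pk : (P k); last by exists 1, 0%N.
  exists `|u k - y|, 0%N; split => //; rewrite normr_gt0 subr_eq0.
  by apply/eqP/H.
- by move=> e [_ [e0 He]]; exists e.
Qed.

Lemma seq_separation (R : realType) (s : seq R) : exists2 rho, 0 < rho &
  forall a b, a \in s -> b \in s -> a <> b -> rho <= `|a - b|.
Proof.
have [d d0 Hd] : exists2 d, 0 < d & forall t, t \in [seq a - b | a <- s, b <- s] ->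
    t <> 0 -> d <= `|t|.
  elim: [seq a - b | a <- s, b <- s] => [|t l [d d0 Hd]]; first by exists 1.
  have [->|/eqP t0] := eqVneq t 0.
    by exists d => // r; rewrite inE => /predU1P[->//|]; exact: Hd.
  exists (Num.min d `|t|); first by rewrite lt_min d0 normr_gt0; apply/eqP.
  move=> r; rewrite inE => /predU1P[-> _|rl r0]; first by rewrite ge_min lexx orbT.
  by rewrite ge_min Hd.
exists d => // a b sa sb ab; apply: Hd; first by apply/allpairsP; exists (a, b).
by move/eqP; rewrite subr_eq0 => /eqP.
Qed.

Lemma closureP (R : realType) (A : set R) (y : R) :
  closure A y <-> forall e : R, 0 < e -> exists2 z, A z & `|z - y| < e.
Proof.
split=> [cl e e0|H B /nbhs_ballP[e /= e0 eB]].
  have [z [Az]] := cl _ (nbhsx_ballx y _ e0).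
  by rewrite -ball_normE /= distrC; exists z.
have [z Az zy] := H e e0; exists z; split => //.
by apply: eB; rewrite -ball_normE /= distrC.
Qed.

(** * Limit sets of orbits of a real map *)

(** Subsequences are replaced by the statement that the orbit returns to each
    neighbourhood at arbitrarily late times. *)
Lemma omega_limitP (R : realType) (f : R -> R) (x y : R) :
  omega_limit f x y <->
  forall (e : R) n, 0 < e -> exists2 m, (n <= m)%N & `|iter m f x - y| < e.
Proof.
split.
  move=> [s s_incr /cvgrPdist_lt sy] e n e0.
  have [K _ HK] := sy e e0.
  have sn m : (m <= s m)%N.
    elim: m => // m IH; exact: leq_ltn_trans IH (s_incr _ _ (ltnSn m)).
  exists (s (maxn n K)); first exact: leq_trans (leq_maxl _ _) (sn _).
  by rewrite distrC; apply: HK; rewrite /= leq_maxr.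
move=> H.
have inv0 (k : nat) : 0 < k.+1%:R^-1 :> R by rewrite invr_gt0 ltr0n.
have [g gP] : exists g : nat -> nat -> nat, forall n k,
    (n <= g n k)%N /\ `|iter (g n k) f x - y| < k.+1%:R^-1.
  have /choice[g gP] : forall p : nat * nat, exists m,
      (p.1 <= m)%N /\ `|iter m f x - y| < p.2.+1%:R^-1.
    by move=> [n k]; have [m] := H _ n (inv0 k); exists m.
  by exists (fun n k => g (n, k)) => n k; exact: (gP (n, k)).
pose s := fix s k := if k is k'.+1 then g (s k').+1 k else g 0%N 0%N.
have sS k : (s k < s k.+1)%N by have [] := gP (s k).+1 k.+1.
have sy k : `|iter (s k) f x - y| < k.+1%:R^-1.
  by case: k => [|k]; [have [] := gP 0%N 0%N|have [] := gP (s k).+1 k.+1].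
exists s; first exact: homo_ltn ltn_trans sS.
apply/cvgrPdist_lt => e e0.
near=> k; rewrite distrC; apply: lt_trans (sy k) _.
by near: k; exact: near_infty_natSinv_lt (PosNum e0).
Unshelve. all: by end_near. Qed.

Lemma omega_limit_asymp (R : realType) (f : R -> R) (x y : R) (p q : nat) :
  (forall e : R, 0 < e -> exists n0, forall n, (n0 <= n)%N ->
     `|iter (n + p) f x - iter (n + q) f y| < e) ->
  omega_limit f x `<=` omega_limit f y.
Proof.
move=> xy z /omega_limitP xz; apply/omega_limitP => e n e0.
have e2 : 0 < e / 2 by rewrite divr_gt0.
have [n0 Hn0] := xy _ e2.
have [m mn mz] := xz _ (n + n0 + p)%N e2.
exists (m - p + q)%N; first by clear -mn; lia.
have := Hn0 (m - p)%N; rewrite subnK; last by clear -mn; lia.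
have : (n0 <= m - p)%N by clear -mn; lia.
move=> h /(_ h); have := ler_distD (iter m f x) (iter (m - p + q) f y) z.
rewrite (distrC (iter (m - p + q) f y) (iter m f x)); lra.
Qed.

Lemma omega_limit_iter (R : realType) (f : R -> R) (x : R) (p : nat) :
  omega_limit f (iter p f x) = omega_limit f x.
Proof.
rewrite eqEsubset; split.
  apply: (@omega_limit_asymp _ _ _ _ 0%N p) => e e0; exists 0%N => n _.
  by rewrite addn0 iterD subrr normr0.
apply: (@omega_limit_asymp _ _ _ _ p 0%N) => e e0; exists 0%N => n _.
by rewrite addn0 iterD subrr normr0.
Qed.

Lemma omega_limit_closed (R : realType) (f : R -> R) (x : R) :
  closed (omega_limit f x).
Proof.
move=> y /closureP cl; apply/omega_limitP => e n e0.
have e2 : 0 < e / 2 by rewrite divr_gt0.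
have [z /omega_limitP/(_ _ n e2)[m nm mz] zy] := cl _ e2.
exists m => //; have := ler_distD z (iter m f x) y; lra.
Qed.

Lemma omega_limit_closure_orbit (R : realType) (f : R -> R) (x : R) :
  omega_limit f x `<=` closure (forward_orbit f x).
Proof.
move=> y /omega_limitP xy; apply/closureP => e e0.
by have [m _ my] := xy e 0%N e0; exists (iter m f x) => //; exists m.
Qed.

Lemma geometric_small (R : realType) (lam B e : R) : 0 < lam < 1 -> 0 < e ->
  exists n0, forall n, (n0 <= n)%N -> lam ^+ n * B < e.
Proof.
move=> /andP[l0 l1] e0; have l1' : `|lam| < 1 by rewrite gtr0_norm.
have /cvgrPdist_lt/(_ e e0)[n0 _ H] := cvg_geometric B l1'.
exists n0 => n /H /=; rewrite sub0r normrN /geometric /= mulrC.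
exact/le_lt_trans/ler_norm.
Qed.

(** The subsequences of step [q] are Cauchy because their increments are
    dominated by a geometric series; their limits depend only on the residue of
    the index modulo [q]. *)
Lemma asymp_periodic (R : realType) (lam B : R) (u : nat -> R) (q : nat) :
  0 < lam < 1 -> (0 < q)%N ->
  (forall t, `|u (t + q)%N - u t| <= lam ^+ t * B) ->
  exists z : nat -> R, (forall t, z (t + q)%N = z t) /\
    forall e : R, 0 < e -> exists n1, forall t, (n1 <= t)%N -> `|u t - z t| < e.
Proof.
move=> lam01 q0 Hu; have /andP[l0 l1] := lam01; pose B' := B / (1 - lam).
have B0 : 0 <= B by have := Hu 0%N; rewrite expr0 mul1r; apply: le_trans.
have B'0 : 0 <= B' by rewrite divr_ge0 //; lra.
(* [B'] is the sum of the geometric series that dominates all later increments. *)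
have BB : B + lam * B' = B' by rewrite /B'; field; lra.
have tele j t : `|u (t + j * q)%N - u t| <= lam ^+ t * B'.
  elim: j t => [|j IH] t.
    by rewrite mul0n addn0 subrr normr0 mulr_ge0 // exprn_ge0 // ltW.
  have h1 := IH (t + q)%N; have h2 := Hu t.
  have h3 : lam ^+ (t + q) * B' <= lam ^+ t * (lam * B').
    rewrite mulrA -exprSr; apply: ler_wpM2r => //.
    by apply: ler_wiXn2l; [exact: ltW..|clear -q0; lia].
  have h4 : lam ^+ t * B' = lam ^+ t * B + lam ^+ t * (lam * B').
    by rewrite -mulrDr BB.
  have := ler_distD (u (t + q)%N) (u (t + j.+1 * q)%N) (u t).
  rewrite mulSn addnA; lra.
have cv t : cvg ((fun j => u (t + j * q)%N) @ \oo).
  apply/cauchy_cvgP/cauchy_exP => e e0.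
  have [j0 Hj0] := geometric_small B' lam01 e0.
  have tj : (j0 <= t + j0 * q)%N.
    by apply: leq_trans (leq_addl _ _); rewrite leq_pmulr.
  exists (u (t + j0 * q)%N); exists j0 => //= j jj.
  rewrite -ball_normE /= distrC.
  have -> : (t + j * q = (t + j0 * q) + (j - j0) * q)%N by rewrite -addnA -mulnDl subnKC.
  exact: le_lt_trans (tele _ _) (Hj0 _ tj).
pose z t : R := lim ((fun j => u (t + j * q)%N) @ \oo).
have zlim t (e : R) : 0 < e -> exists j0, forall j, (j0 <= j)%N -> `|z t - u (t + j * q)%N| < e.
  by move=> e0; have /cvgrPdist_lt/(_ e e0)[j0 _ H] := cv t; exists j0.
exists z; split.
  move=> t; apply/eqP; rewrite -subr_eq0 -normr_le0; apply/ler_addgt0Pr => e e0.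
  have e2 : 0 < e / 2 by rewrite divr_gt0.
  have [j1 H1] := zlim (t + q)%N _ e2; have [j2 H2] := zlim t _ e2.
  have h1 := H1 (j1 + j2)%N (leq_addr _ _).
  have h2 := H2 (j1 + j2).+1 (leqW (leq_addl _ _)).
  have E : (t + q + (j1 + j2) * q = t + (j1 + j2).+1 * q)%N by rewrite mulSn addnA.
  rewrite E in h1; have := ler_distD (u (t + (j1 + j2).+1 * q)%N) (z (t + q)%N) (z t).
  rewrite (distrC (u _) (z t)) add0r; lra.
move=> e e0; have e2 : 0 < e / 2 by rewrite divr_gt0.
have [n1 Hn1] := geometric_small B' lam01 e2; exists n1 => t nt.
have [j1 H1] := zlim t _ e2.
have h1 := tele j1 t; have h2 := Hn1 t nt; have h3 := H1 j1 (leqnn _).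
have := ler_distD (u (t + j1 * q)%N) (u t) (z t).
rewrite (distrC (u t) (u (t + j1 * q)%N)) (distrC (u (t + j1 * q)%N) (z t)); lra.
Qed.

Lemma periodic_mod (T : Type) (z : nat -> T) (q : nat) :
  (forall t, z (t + q)%N = z t) -> forall t, z t = z (t %% q)%N.
Proof.
move=> zq t; rewrite {1}(divn_eq t q) addnC.
by elim: (t %/ q)%N => [|j <-]; rewrite ?mul0n ?addn0 // mulSnr addnA zq.
Qed.

(** A sequence asymptotic to a periodic one visits the same finitely many
    points, hence has no other limit point than these. *)
Lemma omega_limit_periodic (R : realType) (f : R -> R) (x : R) (z : nat -> R) (q : nat) :
  (0 < q)%N -> (forall t, z (t + q)%N = z t) ->
  (forall e : R, 0 < e -> exists n1, forall t, (n1 <= t)%N -> `|iter t f x - z t| < e) ->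
  omega_limit f x = range z.
Proof.
move=> q0 zq xz; rewrite eqEsubset; split => y.
  move=> /omega_limitP xy; apply: contrapT => ny.
  have [|e e0 He] := @finite_far R predT z y q.
    by move=> k _ _ zk; apply: ny; exists k.
  have e2 : 0 < e / 2 by rewrite divr_gt0.
  have [n1 Hn1] := xz _ e2; have [m nm my] := xy _ n1 e2.
  have := He (m %% q)%N (ltn_pmod _ q0) isT; rewrite -(periodic_mod zq).
  have := Hn1 m nm; have := ler_distD (iter m f x) (z m) y.
  rewrite (distrC (z m) (iter m f x)); lra.
move=> [r _ <-]; apply/omega_limitP => e n e0.
have [n1 Hn1] := xz _ e0; pose m := (r + (n + n1) * q)%N.
have mm : (n + n1 <= m)%N.
  by apply: leq_trans (leq_addl _ _); rewrite leq_pmulr.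
exists m; first by clear -mm; lia.
have -> : z r = z m by rewrite (periodic_mod zq m) /m addnC modnMDl -(periodic_mod zq).
by apply: Hn1; clear -mm; lia.
Qed.

Lemma omega_limit_periodic_point (R : realType) (f : R -> R) (z : R) (q : nat) :
  (0 < q)%N -> iter q f z = z -> omega_limit f z = forward_orbit f z.
Proof.
move=> q0 zq; apply: (omega_limit_periodic q0) => [t|e e0].
  by rewrite iterD zq.
by exists 0%N => t _; rewrite subrr normr0.
Qed.

(** * Coverings of real sets by segments *)

Lemma max_sub_min (R : realType) (a b : R) : Num.max a b - Num.min a b = `|b - a|.
Proof.
by case: leP => h; [rewrite ger0_norm|rewrite ltr0_norm]; lra.
Qed.

(** A list of segments given by their end points: such coverings serve to show
    that a set has length zero, since their total length can be controlled
    under a contraction. *)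
Fixpoint cover (R : realType) (s : seq (R * R)) : set R :=
  if s is p :: s' then `[p.1, p.2] `|` cover s' else set0.

Definition total_length (R : realType) (s : seq (R * R)) : R :=
  \sum_(p <- s) (p.2 - p.1).

Lemma coverP (R : realType) (s : seq (R * R)) (x : R) :
  cover s x <-> exists2 p, p \in s & p.1 <= x <= p.2.
Proof.
elim: s => [|p s IH]; first by split => // -[].
split=> /= [[|/IH[q qs xq]]|[q]].
- by rewrite in_itv /=; exists p; rewrite ?mem_head.
- by exists q; rewrite // inE qs orbT.
- rewrite inE => /predU1P[-> h|qs xq]; first by left; rewrite /= in_itv.
  by right; apply/IH; exists q.
Qed.

Lemma cover_closed (R : realType) (s : seq (R * R)) : closed (cover s).
Proof.
elim: s => [|p s IH] /=; first exact: closed0.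
by apply: closedU => //; exact: interval_closed.
Qed.

Lemma cover_measure (R : realType) (s : seq (R * R)) :
  (forall p, p \in s -> p.1 <= p.2) ->
  measurable (cover s) /\ (lebesgue_measure (cover s) <= (total_length s)%:E)%E.
Proof.
rewrite /total_length; elim: s => [|p s IH] ps /=.
  by rewrite big_nil measure0.
have [|ms les] := IH; first by move=> q qs; apply: ps; rewrite inE qs orbT.
have mp : measurable (`[p.1, p.2] : set R) by exact: measurable_itv.
split; first exact: measurableU.
apply: le_trans (measureU2 _ _ _) _ => //.
rewrite big_cons EFinD; apply: leeD => //.
rewrite [leLHS](lebesgue_measure_itv `[p.1, p.2]) /= lte_fin; case: ifP => // _.
by rewrite lee_fin subr_ge0 ps ?mem_head.
Qed.

Lemma cover_segment (R : realType) (s : seq (R * R)) (a b : R) :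
  (forall p, p \in s -> p.1 <= p.2) -> a < b -> `[a, b] `<=` cover s ->
  b - a <= total_length s.
Proof.
move=> ps ab sub; have [ms les] := cover_measure ps.
rewrite -lee_fin; apply: le_trans les.
have -> : (b - a)%:E = lebesgue_measure (`[a, b] : set R).
  by rewrite lebesgue_measure_itv /= lte_fin ab.
by apply: le_measure => //; rewrite inE.
Qed.

(** * Counting values with multiplicity *)

(** Each distinct value occurs at least once, and those outside [P] at least
    twice, among the entries of [s]. *)
Lemma size_undup_weighted (T : eqType) (s : seq T) (P : pred T) :
  (forall x, x \in s -> ~~ P x -> (2 <= count_mem x s)%N) ->
  (size (seq.filter P (undup s)) + 2 * size (seq.filter (predC P) (undup s)) <= size s)%N.
Proof.
move=> H; rewrite -[leqRHS](perm_size (perm_count_undup s)) size_flatten /shape -map_comp.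
rewrite sumnE big_map.
have : {subset undup s <= s} by move=> x; rewrite mem_undup.
elim: (undup s) => // x u IH us; rewrite big_cons /= size_nseq.
have xs : x \in s by apply: us; rewrite mem_head.
have {}IH : (size (seq.filter P u) + 2 * size (seq.filter (predC P) u) <=
    \sum_(i <- u) size (nseq (count_mem i s) i))%N.
  by apply: IH => y yu; apply: us; rewrite inE yu orbT.
have x1 : (0 < count_mem x s)%N by rewrite -has_count has_pred1.
case: ifPn => /= Px.
  by rewrite addSn -add1n; exact: leq_add.
by rewrite mulnS addnCA; apply: leq_add => //; exact: H.
Qed.

(** * Contraction pieces and their branches *)

Lemma contraction_rate (R : realType) (N : nat) (c : nat -> R) (f : R -> R) :
  pcim N c f -> {lam : R | 0 < lam < 1 &
    forall i, (0 < i <= N)%N -> lam.-lipschitz_(piece N c i) f}.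
Proof. by case=> _ _ _ /cid2. Qed.

(** A fixed contraction rate, so that all estimates refer to the same power of
    the same number. *)
Definition rate (R : realType) (N : nat) (c : nat -> R) (f : R -> R)
  (f_pcim : pcim N c f) : R := s2val (contraction_rate f_pcim).

Section Pcim.
Variables (R : realType) (N : nat) (c : nat -> R) (f : R -> R).
Hypothesis f_pcim : pcim N c f.
Hypothesis f_inj : forall i, (0 < i <= N)%N -> set_inj (piece N c i) f.
Hypothesis D_sub : dset N c f `<=` tspace N c f.

Local Notation lam := (rate f_pcim).

Let N_ge2 : (2 <= N)%N. Proof. by case: f_pcim. Qed.
Let c_incr i : (i < N)%N -> c i < c i.+1. Proof. by case: f_pcim => _ h _ _; exact: h. Qed.
Let f_space : set_fun (Defs.space N c) (Defs.space N c) f. Proof. by case: f_pcim. Qed.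
Let lam01 : 0 < lam < 1. Proof. exact: (s2valP (contraction_rate f_pcim)). Qed.
Let f_lip i : (0 < i <= N)%N -> lam.-lipschitz_(piece N c i) f.
Proof. exact: (s2valP' (contraction_rate f_pcim)). Qed.

Local Notation X := (Defs.space N c).
Local Notation Delta := (discont N c).
Local Notation Xt := (tspace N c f).

Lemma c_lt i j : (i < j <= N)%N -> c i < c j.
Proof.
move=> /andP[]; elim: j => // j IH; rewrite ltnS leq_eqVlt => /predU1P[->|ij] jN.
  exact: c_incr.
by apply: lt_trans (IH ij (ltnW jN)) _; apply: c_incr.
Qed.

Lemma c_le i j : (i <= j <= N)%N -> c i <= c j.
Proof.
rewrite leq_eqVlt => /andP[/predU1P[->//|ij] jN].
by apply/ltW/c_lt; rewrite ij.
Qed.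

Lemma c_first_last : c 0%N < c N.
Proof. by apply: c_lt; rewrite leqnn andbT ltnW. Qed.

Lemma spaceP x : X x <-> c 0%N <= x <= c N.
Proof. by rewrite /Defs.space /= in_itv. Qed.

(** The first and the last piece contain their outer end points, which is what
    the exceptions at [1] and [N] record. *)
Lemma pieceP i x : (0 < i <= N)%N -> piece N c i x <->
  [/\ c i.-1 <= x <= c i, i <> 1%N -> c i.-1 < x & i <> N -> x < c i].
Proof.
move=> iN; rewrite /piece /= in_itv /=.
case: (eqVneq i 1%N) => i1; case: (eqVneq i N) => iN'; rewrite /=;
  (split; [case/andP => h1 h2; split => //; rewrite ?(ltW h1) ?(ltW h2) ?h1 ?h2 //|
   case=> /andP[h1 h2] h3 h4; rewrite ?h1 ?h2 ?h3 ?h4 //; by apply/eqP]).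
Qed.

Lemma piece_space i x : (0 < i <= N)%N -> piece N c i x -> X x.
Proof.
move=> iN /(pieceP _ iN)[/andP[h1 h2] _ _]; apply/spaceP.
have := @c_le 0 i.-1; have := @c_le i N; case/andP: iN => i0 iN.
rewrite iN leqnn leq0n => /(_ isT) h3 /(_ _)/[!(leq_trans (leq_pred _) iN)] /(_ isT); lra.
Qed.

Lemma piece_discont i x : (0 < i <= N)%N -> piece N c i x -> ~ Delta x.
Proof.
move=> iN /(pieceP _ iN)[/andP[h1 h2] h3 h4] [k /= kN kx].
have [ki|ik|ki] := ltngtP k i.
- have k1 : (k <= i.-1 <= N)%N by lia.
  have := c_le k1; rewrite kx => xi.
  have : i <> 1%N by lia.
  by move=> /h3; lra.
- have k1 : (i < k <= N)%N by lia.
  by have := c_lt k1; rewrite kx; lra.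
- have : i <> N by lia.
  by move=> /h4; rewrite -kx ki ltxx.
Qed.

Lemma exists_piece x : X x -> ~ Delta x -> exists2 i, (0 < i <= N)%N & piece N c i x.
Proof.
move=> /spaceP/andP[h1 h2] nD.
have ex : exists i, (0 < i <= N)%N && (x <= c i).
  by exists N; rewrite h2; lia.
case: (ex_minnP ex) => i /andP[iN xi] mi; exists i => //; apply/(pieceP _ iN).
have nk k : (0 < k < N)%N -> x <> c k by move=> kN xk; apply: nD; exists k.
have low : c i.-1 <= x /\ (i <> 1%N -> c i.-1 < x).
  case: (eqVneq i 1%N) => [->|/eqP i1]; first by split.
  have i1N : (0 < i.-1 <= N)%N by lia.
  suff : c i.-1 < x by move=> h; split => //; apply: ltW.
  rewrite ltNge; apply/negP => xi1; have := mi i.-1; rewrite i1N xi1 => /(_ isT).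
  by lia.
split; first by rewrite low.1.
  exact: low.2.
move=> iN'; rewrite lt_neqAle xi andbT; apply/eqP/nk; lia.
Qed.

(** The pieces are cut out by the discontinuities, so two points lie in a common
    piece as soon as no discontinuity separates them. *)
Lemma same_piece x y : X x -> ~ Delta x -> X y ->
  (forall k, (0 < k < N)%N -> ~ between x (c k) y) ->
  exists2 i, (0 < i <= N)%N & piece N c i x /\ piece N c i y.
Proof.
move=> Xx nx Xy nk; have [i iN px] := exists_piece Xx nx.
exists i => //; split => //; apply/(pieceP _ iN).
have /(pieceP _ iN)[/andP[x1 x2] x3 x4] := px; have /spaceP/andP[y1 y2] := Xy.
have low : c i.-1 <= y /\ (i <> 1%N -> c i.-1 < y).
  case: (eqVneq i 1%N) => [->|/eqP i1]; first by split.
  suff : c i.-1 < y by move=> h; split => //; apply: ltW.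
  rewrite ltNge; apply/negP => yi.
  by apply: (nk i.-1); [clear -iN i1; lia|right; rewrite yi].
have up : y <= c i /\ (i <> N -> y < c i).
  case: (eqVneq i N) => [->|/eqP i1]; first by split.
  suff : y < c i by move=> h; split => //; apply: ltW.
  rewrite ltNge; apply/negP => yi.
  by apply: (nk i); [clear -iN i1; lia|left; rewrite yi x2].
by split; [rewrite low.1 up.1| exact: low.2|exact: up.2].
Qed.

Lemma c_pred_lt i : (0 < i <= N)%N -> c i.-1 < c i.
Proof. by move=> iN; apply: c_lt; lia. Qed.

(** A point of the closed segment is moved slightly towards the midpoint [m]. *)
Lemma closure_piece i x : (0 < i <= N)%N -> c i.-1 <= x <= c i ->
  closure (piece N c i) x.
Proof.
move=> iN /andP[x1 x2]; have c12 := c_pred_lt iN.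
move=> B /nbhs_ballP[e /= e0 eB].
pose m := (c i.-1 + c i) / 2.
pose t := Num.min (e / (2 * (c i - c i.-1))) (1 / 2).
have e1 : 0 < e / (2 * (c i - c i.-1)) by apply: divr_gt0 => //; lra.
have t0 : 0 < t by rewrite /t lt_min e1 /=; lra.
have t1 : t <= 1 / 2 by rewrite /t ge_min lexx orbT.
have te : t * (c i - c i.-1) < e.
  apply: (@le_lt_trans _ _ (e / (2 * (c i - c i.-1)) * (c i - c i.-1))).
    by apply: ler_wpM2r; [lra|rewrite /t ge_min lexx].
  by rewrite invfM mulrA -mulrA mulVf ?mulr1; lra.
exists (x + t * (m - x)); split.
  have mx1 : c i.-1 < x + t * (m - x) by rewrite /m; nra.
  have mx2 : x + t * (m - x) < c i by rewrite /m; nra.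
  by apply/(pieceP _ iN); rewrite !ltW.
apply: eB; rewrite -ball_normE /= ltr_norml /m; nra.
Qed.

Lemma f_lipP i x y : (0 < i <= N)%N -> piece N c i x -> piece N c i y ->
  `|f x - f y| <= lam * `|x - y|.
Proof. by move=> iN px py; exact: (f_lip iN (conj px py : (_ `*` _) (x, y))). Qed.

Lemma ext_approx i x e : (0 < i <= N)%N -> c i.-1 <= x <= c i -> 0 < e ->
  exists2 y, piece N c i y &
    `|x - y| < e /\ `|piece_ext N c f i x - f y| < e.
Proof.
by move=> iN xi e0; apply: piece_ext_approx => //; exact: closure_piece.
Qed.

Lemma ext_lip i u v : (0 < i <= N)%N -> c i.-1 <= u <= c i ->
    c i.-1 <= v <= c i ->
  `|piece_ext N c f i u - piece_ext N c f i v| <= lam * `|u - v|.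
Proof.
move=> iN ui vi; have /andP[l0 l1] := lam01; apply/ler_addgt0Pr => e e0.
have e4 : 0 < e / 4 by rewrite divr_gt0.
have [u' pu [uu fu]] := ext_approx iN ui e4.
have [v' pv [vv fv]] := ext_approx iN vi e4.
have h := f_lipP iN pu pv.
have h1 : `|u' - v'| <= `|u - v| + e / 2.
  have := ler_distD u u' v'; have := ler_distD v u v'; rewrite (distrC u' u); lra.
have h2 : lam * `|u' - v'| <= lam * `|u - v| + e / 2.
  apply: le_trans (_ : lam * (`|u - v| + e / 2) <= _); last by nra.
  by apply: ler_wpM2l => //; exact: ltW.
have := ler_distD (f u') (piece_ext N c f i u) (piece_ext N c f i v).
have := ler_distD (f v') (f u') (piece_ext N c f i v).
rewrite (distrC (f v') (piece_ext _ _ _ _ _)); lra.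
Qed.

Lemma ext_eq i x : (0 < i <= N)%N -> piece N c i x -> piece_ext N c f i x = f x.
Proof.
move=> iN px; have [_ ->//] := piece_extP f_pcim iN; by rewrite inE.
Qed.

(** A continuous injective map of an interval is strictly monotone; this is where
    injectivity on the pieces is used. *)
Lemma f_monotone_piece i : (0 < i <= N)%N ->
  (forall x y, piece N c i x -> piece N c i y -> x < y -> f x < f y) \/
  (forall x y, piece N c i x -> piece N c i y -> x < y -> f y < f x).
Proof.
move=> iN; have /andP[l0 l1] := lam01.
pose I := Interval (if i == 1%N then BLeft (c i.-1) else BRight (c i.-1))
                 (if i == N then BRight (c i) else BLeft (c i)).
have cont : {within [set` I], continuous f}.
  apply/subspace_continuousP => x px; apply/cvgrPdist_lt => e e0.
  rewrite near_withinE; apply: filterS (nbhsx_ballx x _ e0) => y.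
  rewrite -ball_normE /= => xy py; have := f_lipP iN px py; nra.
have inj : {in I &, injective f}.
  by move=> x y xI yI; apply: (f_inj iN); rewrite inE.
have [mono|mono] := itv_continuous_inj_mono cont inj; [left|right] => x y px py xy;
  exact: mono.
Qed.

(** The sign [s] treats the increasing and the decreasing case at once. Strictness
    survives the passage to the closed piece because two interior points can be
    inserted between [u] and [v]. *)
Lemma ext_mono i (s : R) : (0 < i <= N)%N -> `|s| = 1 ->
  (forall x y, piece N c i x -> piece N c i y -> x < y -> s * f x < s * f y) ->
  forall u v, c i.-1 <= u -> u < v -> v <= c i ->
    s * piece_ext N c f i u < s * piece_ext N c f i v.
Proof.
move=> iN s1 mono u v ui uv vi.
have ui' : c i.-1 <= u <= c i by lra.
have vi' : c i.-1 <= v <= c i by lra.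
(* Interior points of the piece, between which [f] itself can be compared. *)
pose a := u + (v - u) / 3; pose b := u + (v - u) * 2 / 3.
have pa : piece N c i a by apply/pieceP => //; rewrite /a; split; lra.
have pb : piece N c i b by apply/pieceP => //; rewrite /b; split; lra.
have ab : s * f a < s * f b by apply: mono => //; rewrite /a /b; lra.
have h1 : s * piece_ext N c f i u <= s * f a.
  apply/ler_addgt0Pr => e e0.
  have m0 : 0 < Num.min e (a - u) by rewrite lt_min e0 /a; lra.
  have [u' pu [uu fu]] := ext_approx iN ui' m0.
  move: uu fu; rewrite !lt_min => /andP[_ uu] /andP[fu _].
  have : s * f u' < s * f a by apply: mono => //; move: uu; rewrite ltr_norml; lra.
  move: fu; rewrite -[Num.norm _]mul1r -s1 -normrM mulrBr ltr_norml; lra.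
have h2 : s * f b <= s * piece_ext N c f i v.
  apply/ler_addgt0Pr => e e0.
  have m0 : 0 < Num.min e (v - b) by rewrite lt_min e0 /b; lra.
  have [u' pu [uu fu]] := ext_approx iN vi' m0.
  move: uu fu; rewrite !lt_min => /andP[_ uu] /andP[fu _].
  have : s * f b < s * f u' by apply: mono => //; move: uu; rewrite ltr_norml; lra.
  move: fu; rewrite -[Num.norm _]mul1r -s1 -normrM mulrBr ltr_norml; lra.
lra.
Qed.

(** The [i]-th branch of [f], continued to the line by constants outside the closed
    piece. The constants are the one-sided values of [f] at the two ends of the
    piece, so applying the branch to a point beyond an end replaces that point
    by the corresponding discontinuity. This makes contraction and preservation
    of betweenness hold without any condition on the arguments. *)
Definition branch i u := piece_ext N c f i (clamp (c i.-1) (c i) u).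

Lemma clamp_in i u : (0 < i <= N)%N ->
  c i.-1 <= clamp (c i.-1) (c i) u <= c i.
Proof.
move=> iN; have c12 := c_pred_lt iN.
by case: (clampP u (ltW c12)) => -[h ->]; lra.
Qed.

Lemma branch_lip i u v : (0 < i <= N)%N ->
  `|branch i u - branch i v| <= lam * `|u - v|.
Proof.
move=> iN; have c12 := c_pred_lt iN; have /andP[l0 l1] := lam01.
apply: le_trans (ext_lip iN (clamp_in u iN) (clamp_in v iN)) _.
apply: ler_wpM2l; first exact: ltW.
have := ler_norm (u - v); have := ler_norm (v - u); rewrite (distrC v u) ler_norml.
by case: (clampP u (ltW c12)) => -[hu ->]; case: (clampP v (ltW c12)) => -[hv ->]; lra.
Qed.

Lemma branchE i x : (0 < i <= N)%N -> piece N c i x -> branch i x = f x.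
Proof.
move=> iN px; rewrite /branch -(ext_eq iN px); congr piece_ext.
have c12 := c_pred_lt iN; have /(pieceP _ iN)[xi _ _] := px.
by case: (clampP x (ltW c12)) => -[h ->] //; lra.
Qed.

Lemma branch_strict i : (0 < i <= N)%N -> exists2 s : R, `|s| = 1 &
  forall u v, c i.-1 <= u -> u < v -> v <= c i -> s * branch i u < s * branch i v.
Proof.
move=> iN; have c12 := c_pred_lt iN.
have [s s1 mono] : exists2 s : R, `|s| = 1 & forall x y, piece N c i x ->
    piece N c i y -> x < y -> s * f x < s * f y.
  have [m|m] := f_monotone_piece iN; [exists 1|exists (-1)]; rewrite ?normrN ?normr1 //
    => x y px py xy; have := m x y px py xy; lra.
exists s => // u v ui uv vi; rewrite /branch.
have -> : clamp (c i.-1) (c i) u = u by case: (clampP u (ltW c12)) => -[h ->] //; lra.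
have -> : clamp (c i.-1) (c i) v = v by case: (clampP v (ltW c12)) => -[h ->] //; lra.
exact: (ext_mono iN s1 mono ui uv vi).
Qed.

Lemma branch_clamp i u : (0 < i <= N)%N ->
  branch i (clamp (c i.-1) (c i) u) = branch i u.
Proof. by move=> iN; rewrite /branch (clampK _ (ltW (c_pred_lt iN))). Qed.

Lemma branch_between i u x v : (0 < i <= N)%N -> between u x v ->
  between (branch i u) (branch i x) (branch i v).
Proof.
move=> iN uxv; have c12 := c_pred_lt iN; have [s s1 mono] := branch_strict iN.
have mono' a b : a <= b -> s * branch i a <= s * branch i b.
  move=> ab; rewrite -(branch_clamp a iN) -(branch_clamp b iN).
  have := clamp_in a iN; have := clamp_in b iN.
  have := clamp_le (ltW c12) ab; rewrite le_eqVlt => /predU1P[-> //|lt] hb ha; apply/ltW/mono => //; lra.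
by case: uxv => /andP[/mono' h1 /mono' h2]; [|apply: between_sym];
  exact: sign_between s1 h1 h2.
Qed.

Lemma branch_inj i u v : (0 < i <= N)%N ->
  clamp (c i.-1) (c i) u <> clamp (c i.-1) (c i) v -> branch i u <> branch i v.
Proof.
move=> iN; have [s s1 mono] := branch_strict iN.
move=> uv; rewrite -(branch_clamp u iN) -(branch_clamp v iN) => E.
have /andP[u1 u2] := clamp_in u iN; have /andP[v1 v2] := clamp_in v iN.
have [h|h|//] := ltgtP (clamp (c i.-1) (c i) u) (clamp (c i.-1) (c i) v).
- by have := mono _ _ u1 h v2; rewrite E ltxx.
- by have := mono _ _ v1 h u2; rewrite E ltxx.
Qed.

(** One-sided values of [f] at [c k], with [true] for the right-hand side. *)
Definition dval k (s : bool) : R := if s then d_plus N c f k else d_minus N c f k.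

(** Seen from a point [x] of the piece, a point [u] of another piece lies behind
    one of the two ends of the piece of [x]; the branch sends it to the value of
    [f] at that end, taken on the side of [x]. *)
Lemma branch_cut i x u : (0 < i <= N)%N -> piece N c i x -> X u ->
  piece N c i u \/ exists k s, [/\ (0 < k < N)%N, branch i u = dval k s &
    if s then u <= c k < x else x < c k <= u].
Proof.
move=> iN px Xu; have c12 := c_pred_lt iN; have /(pieceP _ iN)[xi x1 x2] := px.
have /spaceP/andP[u0 uN] := Xu.
have [ui|iu] := leP u (c i.-1).
  case: (eqVneq i 1%N) => [i1|/eqP i1].
    left; apply/(pieceP _ iN); rewrite i1 /= in ui c12 *; split => //; lra.
  right; exists i.-1, true; rewrite ui x1 //=; split => //; first by clear -iN i1; lia.
  rewrite /branch /d_plus; have -> : i.-1.+1 = i by clear -iN; lia.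
  by congr piece_ext; case: (clampP u (ltW c12)) => -[h ->] //; lra.
have [iu'|ui'] := leP (c i) u.
  case: (eqVneq i N) => [i1|/eqP i1].
    left; apply/(pieceP _ iN); subst i; split => //; lra.
  right; exists i, false; rewrite iu' x2 //=; split => //; first by clear -iN i1; lia.
  by rewrite /branch /d_minus; congr piece_ext; case: (clampP u (ltW c12)) => -[h ->] //; lra.
by left; apply/(pieceP _ iN); split; lra.
Qed.

(** * Points whose orbits avoid the discontinuities *)

Lemma tspace_space x : Xt x -> X x. Proof. by case. Qed.

Lemma tspace_iter x n : Xt x -> Xt (iter n f x).
Proof.
by move=> [Xx H]; split => [|m]; [have [] := H n|rewrite -iterD; exact: H].
Qed.

Lemma tspace_f x : Xt x -> Xt (f x).
Proof. exact: (@tspace_iter x 1). Qed.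

Lemma tspace_discont x : Xt x -> ~ Delta x.
Proof. by move=> [_ /(_ 0%N)[]]. Qed.

Lemma tspace_neq x k : Xt x -> (0 < k < N)%N -> x <> c k.
Proof. by move=> /tspace_discont nx kN xk; apply: nx; exists k. Qed.

Lemma space_iter x n : X x -> X (iter n f x).
Proof. by move=> Xx; elim: n => //= n IH; exact: f_space. Qed.

Lemma tspace_piece x : Xt x -> exists2 i, (0 < i <= N)%N & piece N c i x.
Proof. by move=> tx; apply: exists_piece; [exact: tspace_space|exact: tspace_discont]. Qed.

Lemma dval_tspace k s : (0 < k < N)%N -> Xt (dval k s).
Proof.
move=> kN; apply: D_sub; case: s; [right|left; right]; by exists k.
Qed.

Lemma tspace_preim x : X x -> ~ Delta x -> Xt (f x) -> Xt x.
Proof.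
by move=> Xx nx [_ H]; split=> // -[//|n]; rewrite iterSr; exact: H.
Qed.

Lemma piece_first : piece N c 1 (c 0%N).
Proof.
have N0 : (0 < 1 <= N)%N := ltnW N_ge2.
have := c_pred_lt N0 => /= c01.
by apply/(pieceP _ N0) => /=; split; [rewrite lexx ltW|move=>/(_ erefl)|].
Qed.

Lemma piece_last : piece N c N (c N).
Proof.
have N0 : (0 < N <= N)%N by rewrite leqnn andbT ltnW.
have cNN := c_pred_lt N0.
by apply/(pieceP _ N0) => /=; split => //; rewrite lexx ltW.
Qed.

Lemma f_first : f (c 0%N) = d_first N c f.
Proof.
have N0 : (0 < 1 <= N)%N := ltnW N_ge2.
by rewrite -(ext_eq N0 piece_first).
Qed.

Lemma f_last : f (c N) = d_last N c f.
Proof.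
have N0 : (0 < N <= N)%N by rewrite leqnn andbT ltnW.
by rewrite -(ext_eq N0 piece_last).
Qed.

Lemma tspace_first : Xt (c 0%N).
Proof.
have N0 : (0 < 1 <= N)%N := ltnW N_ge2.
apply: tspace_preim.
- exact: piece_space N0 piece_first.
- exact: piece_discont N0 piece_first.
- by rewrite f_first; apply: D_sub; left; left; left.
Qed.

Lemma tspace_last : Xt (c N).
Proof.
have N0 : (0 < N <= N)%N by rewrite leqnn andbT ltnW.
apply: tspace_preim.
- exact: piece_space N0 piece_last.
- exact: piece_discont N0 piece_last.
- by rewrite f_last; apply: D_sub; left; left; right.
Qed.

(** * Following an orbit between two others *)

(** How a companion [u] of the orbit point [x] moves in one step: with [f] when
    both lie in the same piece, and otherwise to the one-sided value at a
    discontinuity that separates them, on the side of [x]. *)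
Definition end_step x u u' : Prop := u' = f u \/ exists k s,
  [/\ (0 < k < N)%N, u' = dval k s & if s then u < c k < x else x < c k < u].

Lemma branch_end_step i x u : (0 < i <= N)%N -> piece N c i x -> Xt u ->
  end_step x u (branch i u).
Proof.
move=> iN px tu; case: (branch_cut iN px (tspace_space tu)).
  by move=> pu; left; rewrite branchE.
case=> k [s [kN uk h]]; right; exists k, s; split => //.
have /eqP/negPf uck := tspace_neq tu kN.
by case: s h {uk}; rewrite le_eqVlt ?uck // eq_sym uck.
Qed.

Lemma end_step_tspace x u u' : Xt u -> end_step x u u' -> Xt u'.
Proof.
by move=> tu [->|[k [s [kN -> _]]]]; [exact: tspace_f|exact: dval_tspace].
Qed.

(** Enclosures of an orbit propagate: the branch of the piece of [x] is monotone
    and contracting on the whole line. Both ends stay distinct because the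
    branch is injective on the closed piece and the enclosure meets the piece. *)
Lemma follow x u v : X x -> ~ Delta x -> Xt u -> Xt v -> between u x v ->
  exists u' v', [/\ between u' (f x) v', `|u' - v'| <= lam * `|u - v|,
    (u <> v -> u' <> v'), end_step x u u' & end_step x v v'].
Proof.
move=> Xx nx tu tv uxv; have [i iN px] := exists_piece Xx nx.
exists (branch i u), (branch i v); split.
- by rewrite -(branchE iN px); exact: branch_between.
- exact: branch_lip.
- move=> uv; apply: branch_inj => // E.
  have c12 := c_pred_lt iN; have /(pieceP _ iN)[xi x1 x2] := px.
  have /spaceP/andP[u0 uN] := tspace_space tu.
  have /spaceP/andP[v0 vN] := tspace_space tv.
  have [//|[ul vl]|[ur vr]] := clamp_eq c12 E.
    have xl : x <= c i.-1 by case: uxv; lra.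
    have : c i.-1 = c 0%N by case: (eqVneq i 1%N) => [->//|/eqP/x1]; lra.
    by move=> ci; apply: uv; lra.
  have xr : c i <= x by case: uxv; lra.
  have : c i = c N by case: (eqVneq i N) => [->//|/eqP/x2]; lra.
  by move=> ci; apply: uv; lra.
- exact: branch_end_step.
- exact: branch_end_step.
Qed.

(** No discontinuity separates [x] from [y], so that [f] acts on both by the same
    branch. *)
Definition nosep x y : Prop := forall k, (0 < k < N)%N -> ~ between x (c k) y.

Lemma nosep_step x y : Xt x -> X y -> nosep x y ->
  `|f x - f y| <= lam * `|x - y| /\
  forall z, between x z y -> between (f x) (f z) (f y).
Proof.
move=> tx Xy nxy.
have [i iN [px py]] := same_piece (tspace_space tx) (tspace_discont tx) Xy nxy.
split; first exact: f_lipP iN px py.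
move=> z xzy; have pz : piece N c i z.
  move/(pieceP _ iN): px => [x1 x2 x3]; move/(pieceP _ iN): py => [y1 y2 y3].
  apply/(pieceP _ iN); split.
  - by case: xzy; lra.
  - by move=> h; have := x2 h; have := y2 h; case: xzy; lra.
  - by move=> h; have := x3 h; have := y3 h; case: xzy; lra.
by rewrite -!(branchE iN) //; exact: branch_between.
Qed.

Lemma nosep_iter x y m : Xt x -> X y ->
  (forall j, (j < m)%N -> nosep (iter j f x) (iter j f y)) ->
  `|iter m f x - iter m f y| <= lam ^+ m * `|x - y| /\
  forall z, between x z y -> between (iter m f x) (iter m f z) (iter m f y).
Proof.
move=> tx Xy; have /andP[l0 l1] := lam01; elim: m => [|m IH] nxy.
  by split => //; rewrite expr0 mul1r.
have [h1 h2] := IH (fun j jm => nxy j (ltnW jm)).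
have [h3 h4] := nosep_step (tspace_iter m tx) (space_iter m Xy) (nxy m (ltnSn m)).
split; last by move=> z /h2/h4.
apply: le_trans h3 _; rewrite exprS -mulrA; apply: ler_wpM2l => //; exact: ltW.
Qed.

Lemma lam_pow_le1 m : 0 < lam ^+ m <= 1.
Proof.
have /andP[l0 l1] := lam01.
by rewrite exprn_gt0 //= exprn_ile1 // ltW.
Qed.

Lemma lam_small B e : 0 < e ->
  exists n0, forall n, (n0 <= n)%N -> lam ^+ n * B < e.
Proof. exact: geometric_small. Qed.

Definition far d x : Prop := forall k, (0 < k < N)%N -> d <= `|x - c k|.

(** The contraction keeps the two orbits closer together than the distance from
    the orbit of [y] to the discontinuities, so they are never separated and the
    contraction goes on. *)
Lemma shadow x y d : Xt y -> X x ->
  (forall m, far d (iter m f y)) -> `|x - y| < d ->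
  forall m, `|iter m f x - iter m f y| <= lam ^+ m * `|x - y|.
Proof.
move=> ty Xx fy xy m; rewrite distrC (distrC x).
apply: (nosep_iter ty Xx _).1 => j _.
elim/ltn_ind: j => j IH k kN ykx.
have [h _] := nosep_iter ty Xx IH.
have := fy j k kN; have /andP[_] := lam_pow_le1 j.
have : lam ^+ j * `|y - x| <= `|y - x|.
  by apply: ler_piMl => //; have /andP[] := lam_pow_le1 j.
rewrite (distrC y x) in h *; move: h xy; set A := `|x - y|.
have -> : `|iter j f y - iter j f x| = `|iter j f y - c k| + `|c k - iter j f x|.
  case: ykx => h; do 3?[rewrite ler0_norm; last by lra];
   do 3?[rewrite ger0_norm; last by lra]; lra.
have := normr_ge0 (c k - iter j f x); lra.
Qed.

(** * Approaching a discontinuity from one side *)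

Definition side k (s : bool) e x : bool :=
  if s then c k < x < c k + e else c k - e < x < c k.

(** The orbit of [x] enters the side [s] of [c k] arbitrarily deeply at
    arbitrarily late times. *)
Definition approaches x k s : Prop :=
  forall (e : R) n, 0 < e -> exists2 m, (n <= m)%N & side k s e (iter m f x).

(** When the orbit of [x] avoids the discontinuities, this means that it stays at a
    positive distance from them. Such orbits converge to cycles; the limit sets of
    the others turn out to be Cantor sets. *)
Definition regular x : Prop :=
  forall k, (0 < k < N)%N -> ~ omega_limit f x (c k).

Lemma side_dist k s e x : side k s e x -> `|x - c k| < e.
Proof. by rewrite /side ltr_norml; case: s; lra. Qed.

Lemma side_le k s e e' x : e <= e' -> side k s e x -> side k s e' x.
Proof. by rewrite /side; case: s; lra. Qed.

Lemma discont_far x : ~ Delta x -> exists2 d, 0 < d & far d x.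
Proof.
move=> nx; have [k kN kP|d d0 H] := @finite_far R (fun k => 0 < k < N)%N c x N.
  by move=> ck; apply: nx; exists k.
exists d => // k kN; rewrite distrC; apply: H => //.
by case/andP: kN.
Qed.

Lemma tspace_far x : Xt x -> exists2 d, 0 < d & far d x.
Proof. by move=> /tspace_discont/discont_far. Qed.

(** Late iterates stay away from each [c k] because it is no limit point, and the
    finitely many early ones do because they are not discontinuities. *)
Lemma regular_far x : Xt x -> regular x ->
  exists2 d, 0 < d & forall m, far d (iter m f x).
Proof.
move=> tx reg.
have [e [n [e0 H]]] : exists e n, 0 < e /\ forall k, (k < N)%N -> (0 < k)%N ->
    forall m, (n <= m)%N -> e <= `|iter m f x - c k|.
  apply: (@uniform_pos R (fun k e n => (0 < k)%N ->
    forall m, (n <= m)%N -> e <= `|iter m f x - c k|)).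
    move=> k e n e' n' h _ ee nn k0 m nm.
    by apply: le_trans ee _; apply: h => //; exact: leq_trans nm.
  move=> k kN; case: (posnP k) => [->|k0]; first by exists 1, 0%N.
  apply: contrapT => nex; apply: (reg k); first by rewrite k0.
  apply/omega_limitP => e n e0; apply: contrapT => nm; apply: nex.
  exists e, n; split => // _ m mn; rewrite leNgt; apply/negP => h.
  by apply: nm; exists m.
have [d [_ [d0 Hd]]] : exists (d : R) (n' : nat), 0 < d /\
    forall m, (m < n)%N -> far d (iter m f x).
  apply: (@uniform_pos R (fun m d _ => far d (iter m f x))).
    by move=> m d _ d' _ h _ dd _ k /h; exact: le_trans.
  by move=> m _; have [d d0 h] := tspace_far (tspace_iter m tx); exists d, 0%N.
exists (Num.min d e) => [|m k kN]; first by rewrite lt_min d0.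
rewrite ge_min; have [mn|nm] := ltnP m n; first by rewrite Hd.
by rewrite H ?orbT //; case/andP: kN.
Qed.

Lemma approaches_omega_c x k s : approaches x k s -> omega_limit f x (c k).
Proof.
move=> h; apply/omega_limitP => e n e0; have [m nm /side_dist] := h e n e0.
by exists m.
Qed.

(** The orbit never hits [c k], so if it came close to [c k] from neither side it
    would not come close at all. *)
Lemma omega_c_approaches x k : Xt x -> (0 < k < N)%N ->
  omega_limit f x (c k) -> exists s, approaches x k s.
Proof.
move=> tx kN /omega_limitP xk; apply: contrapT => nex.
have nap s : exists e n, 0 < e /\ forall m, (n <= m)%N -> ~ side k s e (iter m f x).
  apply: contrapT => H; apply: nex; exists s => e n e0.
  apply: contrapT => nm; apply: H; exists e, n; split => // m mn sm.
  by apply: nm; exists m.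
have [e1 [n1 [e10 H1]]] := nap true; have [e2 [n2 [e20 H2]]] := nap false.
have m0 : 0 < Num.min e1 e2 by rewrite lt_min e10.
have [m nm] := xk _ (n1 + n2)%N m0; rewrite lt_min => /andP[me1 me2].
have /eqP := tspace_neq (tspace_iter m tx) kN; rewrite neq_lt => /orP[lt|gt].
  apply: (H2 m); first exact: leq_trans (leq_addl _ _) nm.
  by move: me2; rewrite ltr_norml /side lt; lra.
apply: (H1 m); first exact: leq_trans (leq_addr _ _) nm.
by move: me1; rewrite ltr_norml /side gt; lra.
Qed.

Lemma irregular_approaches x : Xt x -> ~ regular x ->
  exists k s, (0 < k < N)%N /\ approaches x k s.
Proof.
move=> tx nreg; apply: contrapT => nex; apply: nreg => k kN xk.
have [s xks] := omega_c_approaches tx kN xk.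
by apply: nex; exists k, s.
Qed.

Lemma approaches_irregular x k s : (0 < k < N)%N -> approaches x k s -> ~ regular x.
Proof. by move=> kN /approaches_omega_c xk /(_ k kN). Qed.

(** * Orbits that stay away from the discontinuities *)

Lemma far_nosep d x y : far d y -> `|x - y| < d -> nosep y x.
Proof.
move=> fy xy k kN h; have := fy k kN; have : `|y - c k| <= `|x - y|.
  rewrite (distrC x y); case: h => h.
    by rewrite !ler0_norm; lra.
  by rewrite !ger0_norm; lra.
lra.
Qed.

(** Continuity of [f] away from the discontinuities, in quantitative form. *)
Lemma far_cont d x y : 0 < d -> X y -> far d y -> X x -> `|x - y| < d ->
  `|f x - f y| <= lam * `|x - y|.
Proof.
move=> d0 Xy fy Xx xy; rewrite distrC (distrC x).
have ny : ~ Delta y.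
  by move=> [k kN cy]; have := fy k kN; rewrite cy subrr normr0; lra.
by have [i iN [py px]] := same_piece Xy ny Xx (far_nosep fy xy); exact: f_lipP iN py px.
Qed.

Lemma space_closed : closed X.
Proof. by rewrite /Defs.space; exact: interval_closed. Qed.

Lemma omega_limit_space x : X x -> omega_limit f x `<=` X.
Proof.
move=> Xx y /omega_limitP xy; apply: space_closed; apply/closureP => e e0.
by have [m _ my] := xy e 0%N e0; exists (iter m f x) => //; exact: space_iter.
Qed.

Lemma omega_limit_nonempty x : X x -> exists y, omega_limit f x y.
Proof.
move=> Xx; pose F := (fun n => iter n f x) @ \oo.
have FX : F X by exists 0%N => // n _; exact: space_iter.
have [y [_ cly]] := @segment_compact R (c 0%N) (c N) F _ FX.
exists y; apply/omega_limitP => e n e0.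
have Fn : F [set z | exists2 m, (n <= m)%N & z = iter m f x].
  by exists n => // m nm; exists m.
have [z [[m nm ->]]] := cly _ _ Fn (nbhsx_ballx y _ e0).
by rewrite -ball_normE /= distrC; exists m.
Qed.

Lemma omega_limit_f x y : X x -> ~ Delta y -> omega_limit f x y ->
  omega_limit f x (f y).
Proof.
move=> Xx ny xy; have Xy := omega_limit_space Xx xy.
have [d d0 fy] := discont_far ny; move/omega_limitP: xy => xy.
apply/omega_limitP => e n e0; have m0 : 0 < Num.min d e by rewrite lt_min d0.
have [m nm] := xy _ n m0; rewrite lt_min => /andP[md me].
exists m.+1; first exact: leqW.
apply: le_lt_trans (far_cont d0 Xy fy (space_iter m Xx) md) _.
have /andP[l0 l1] := lam01; have := normr_ge0 (iter m f x - y); nra.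
Qed.

Lemma omega_limit_orbit x y n : X x -> Xt y -> omega_limit f x y ->
  omega_limit f x (iter n f y).
Proof.
move=> Xx ty xy; elim: n => //= n IH; apply: omega_limit_f => //.
exact/tspace_discont/tspace_iter.
Qed.

Lemma closure_orbit_omega x y : X x -> Xt y -> omega_limit f x y ->
  closure (forward_orbit f y) `<=` omega_limit f x.
Proof.
move=> Xx ty xy z /closureP cl; apply: (@omega_limit_closed _ f x).
apply/closureP => e /cl[_ [n _ <-]]; exists (iter n f y) => //.
exact: omega_limit_orbit.
Qed.

Lemma side_open k s e x : side k s e x -> exists2 d, 0 < d &
  forall y, `|y - x| < d -> side k s e y.
Proof.
rewrite /side; case: s => h.
  exists (Num.min (x - c k) (c k + e - x)); first by rewrite lt_min; lra.
  by move=> y; rewrite lt_min !ltr_norml; lra.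
exists (Num.min (c k - x) (x - c k + e)); first by rewrite lt_min; lra.
by move=> y; rewrite lt_min !ltr_norml; lra.
Qed.

Lemma omega_limit_side x y k s e n : omega_limit f x y -> side k s e y ->
  exists2 m, (n <= m)%N & side k s e (iter m f x).
Proof.
move=> /omega_limitP xy /side_open[d d0 H]; have [m nm my] := xy d n d0.
by exists m => //; exact: H.
Qed.

Lemma approaches_trans x y k s : X x -> Xt y -> omega_limit f x y ->
  approaches y k s -> approaches x k s.
Proof.
move=> Xx ty xy yk e n e0; have [m _ my] := yk e 0%N e0.
exact: omega_limit_side (omega_limit_orbit m Xx ty xy) my.
Qed.

Definition germ_piece k (s : bool) := if s then k.+1 else k.

Lemma germ_piece_ok k s : (0 < k < N)%N -> (0 < germ_piece k s <= N)%N.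
Proof. by case: s => /=; clear; lia. Qed.

Lemma branch_germ k s : (0 < k < N)%N -> branch (germ_piece k s) (c k) = dval k s.
Proof.
move=> kN; have kN' := germ_piece_ok s kN; have := c_pred_lt kN'.
rewrite /branch /dval; case: s {kN'} => /= ck; congr piece_ext;
  by case: (clampP (c k) (ltW ck)) => -[h ->] //; lra.
Qed.

(** Each side of each discontinuity is locally a part of one piece, at a scale that
    can be chosen uniformly. *)
Lemma side_piece : exists2 e0, 0 < e0 & forall k s e x, (0 < k < N)%N -> e <= e0 ->
  side k s e x -> piece N c (germ_piece k s) x.
Proof.
have [e0 [_ [e00 H]]] : exists (e : R) (n : nat), 0 < e /\
    forall k, (k < N)%N -> e <= c k.+1 - c k.
  apply: (@uniform_pos R (fun k e _ => e <= c k.+1 - c k)).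
    by move=> k e n e' n' h _ ee _; exact: le_trans ee h.
  by move=> k kN; exists (c k.+1 - c k), 0%N; rewrite subr_gt0 c_incr.
exists e0 => // k s e x kN ee sx; have gN := germ_piece_ok s kN.
apply/(pieceP _ gN); case: s sx gN; rewrite /side /= => sx gN.
  have := H k; have -> : (k < N)%N by case/andP: kN.
  by move=> /(_ isT); split; lra.
have k1 : k.-1.+1 = k by rewrite prednK //; case/andP: kN.
have := H k.-1; have -> : (k.-1 < N)%N by clear -kN; lia.
by rewrite k1 => /(_ isT); split; lra.
Qed.

Lemma germ_dist k s x : (0 < k < N)%N -> piece N c (germ_piece k s) x ->
  `|f x - dval k s| <= lam * `|x - c k|.
Proof.
move=> kN px; have gN := germ_piece_ok s kN.
by rewrite -(branchE gN px) -branch_germ //; exact: branch_lip.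
Qed.

(** Deep in the side [s] of [c k] the map is close to its one-sided value there. *)
Lemma approaches_dval x k s : (0 < k < N)%N -> approaches x k s ->
  omega_limit f x (dval k s).
Proof.
move=> kN xk; have [e0 e00 He0] := side_piece; apply/omega_limitP => e n e_gt0.
have m0 : 0 < Num.min e0 e by rewrite lt_min e00.
have [m nm sm] := xk _ n m0; exists m.+1; first exact: leqW.
have pm : piece N c (germ_piece k s) (iter m f x).
  by apply: He0 kN _ sm; rewrite ge_min lexx.
apply: le_lt_trans (germ_dist kN pm) _.
have := side_dist sm; rewrite lt_min => /andP[_ me].
have /andP[l0 l1] := lam01; have := normr_ge0 (iter m f x - c k); nra.
Qed.

(** Once an orbit comes closer to [y] than the orbit of [y] comes to the
    discontinuities, the two orbits are asymptotic. *)
Lemma far_attract d x y p : Xt y -> X x -> 0 < d -> (forall m, far d (iter m f y)) ->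
  `|iter p f x - y| < d ->
  omega_limit f x = omega_limit f y.
Proof.
move=> ty Xx d0 fy xy; have sh := shadow ty (space_iter p Xx) fy xy.
rewrite eqEsubset; split.
  apply: (@omega_limit_asymp _ _ _ _ p 0%N) => e e0.
  have [n0 H] := lam_small `|iter p f x - y| e0; exists n0 => n /H h.
  by rewrite addn0 iterD; exact: le_lt_trans (sh n) h.
apply: (@omega_limit_asymp _ _ _ _ 0%N p) => e e0.
have [n0 H] := lam_small `|iter p f x - y| e0; exists n0 => n /H h.
by rewrite addn0 iterD distrC; exact: le_lt_trans (sh n) h.
Qed.

Lemma regular_attract x y : Xt y -> X x -> regular y -> omega_limit f x y ->
  omega_limit f x = omega_limit f y.
Proof.
move=> ty Xx ry /omega_limitP xy; have [d d0 fy] := regular_far ty ry.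
by have [p _ px] := xy d 0%N d0; exact: far_attract px.
Qed.

(** Otherwise the orbit of [x] would come so close to [dval k s] as to be absorbed
    by its orbit, and would then stay away from [c k]. *)
Lemma approaches_irregular_dval x k s : Xt x -> (0 < k < N)%N -> approaches x k s ->
  ~ regular (dval k s).
Proof.
move=> tx kN xk rd; apply: (approaches_irregular kN xk) => j jN.
have td := dval_tspace s kN.
rewrite (regular_attract td (tspace_space tx) rd); first exact: rd.
exact: approaches_dval.
Qed.

(** By compactness two iterates of [x] are closer together than the orbit is to
    the discontinuities. They are never separated, so shifting the time by
    their difference [q] changes the orbit by a geometrically small amount and
    the orbit is asymptotic to a cycle. The cycle keeps the same distance from
    the discontinuities, so it is an orbit of [f]. *)
Lemma regular_periodic x : Xt x -> regular x -> exists z q,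
  [/\ Xt z, (0 < q)%N, iter q f z = z, regular z & omega_limit f x = forward_orbit f z].
Proof.
move=> tx rx; have [d d0 fx] := regular_far tx rx; have Xx := tspace_space tx.
have [y /omega_limitP xy] := omega_limit_nonempty Xx.
have d2 : 0 < d / 2 by rewrite divr_gt0.
have [n _ ny] := xy _ 0%N d2; have [m nm my] := xy _ n.+1 d2.
have nmd : `|iter m f x - iter n f x| < d.
  have := ler_distD y (iter m f x) (iter n f x).
  by rewrite (distrC y (iter n f x)); lra.
pose q := (m - n)%N; have q0 : (0 < q)%N by rewrite /q subn_gt0.
have /andP[l0 l1] := lam01.
pose w := iter n f x; have tw : Xt w by exact: tspace_iter.
have fw j : far d (iter j f w) by rewrite -iterD; exact: fx.
have wq : iter q f w = iter m f x by rewrite -iterD subnK // ltnW.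
have near_per t : `|iter (t + q) f w - iter t f w| <= lam ^+ t * d.
  have := shadow tw (space_iter m Xx) fw nmd t; rewrite -wq -iterD => h.
  by apply: le_trans h _; rewrite ler_pM2l ?exprn_gt0 // ltW // wq.
have [z [zq xz]] := @asymp_periodic R lam d (fun t => iter t f w) q lam01 q0 near_per.
have omE := omega_limit_periodic q0 zq xz.
rewrite omega_limit_iter in omE.
have oz t : omega_limit f w (z t) by rewrite omega_limit_iter omE; exists t.
have fz t : far d (z t).
  move=> k kN; apply/ler_addgt0Pr => e e0.
  have /omega_limitP/(_ e 0%N e0)[j _ jz] := oz t.
  have := fw j k kN; have := ler_distD (z t) (iter j f w) (c k); lra.
have Xz t : X (z t) by exact: omega_limit_space (tspace_space tw) _ (oz t).
(* The points [z t] are only known as limits; continuity of [f] away from the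
   discontinuities makes them an orbit. *)
have zS t : f (z t) = z t.+1.
  apply/eqP; rewrite -subr_eq0 -normr_le0; apply/ler_addgt0Pr => e e0; rewrite add0r.
  have m0 : 0 < Num.min d (e / 2) by rewrite lt_min d0 divr_gt0.
  have [n1 Hn1] := xz _ m0; pose j := (t + n1 * q)%N.
  have n1j : (n1 <= j)%N by apply: leq_trans (leq_addl _ _); rewrite leq_pmulr.
  have zj i : z (i + n1 * q)%N = z i by rewrite (periodic_mod zq) addnC modnMDl -(periodic_mod zq).
  have := Hn1 j n1j; rewrite zj lt_min => /andP[h1 h2].
  have := far_cont d0 (Xz t) (fz t) (space_iter j (tspace_space tw)) h1.
  have := Hn1 j.+1 (leqW n1j); rewrite -addSn zj lt_min => /andP[_ h3].
  have : lam * `|iter j f w - z t| <= `|iter j f w - z t|.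
    by apply: ler_piMl => //; exact: ltW.
  have := ler_distD (iter j.+1 f w) (f (z t)) (z t.+1).
  rewrite (distrC (f (z t)) (iter j.+1 f w)) /=; lra.
have zE t : iter t f (z 0%N) = z t by elim: t => //= t ->.
have zper : iter q f (z 0%N) = z 0%N by rewrite zE -[q]add0n zq.
have zorb : omega_limit f x = forward_orbit f (z 0%N).
  by rewrite omE /forward_orbit; under [in RHS]eq_fun do rewrite zE.
exists (z 0%N), q; split => //.
  split=> // j; rewrite zE; split => // -[k kN ck].
  by have := fz j k kN; rewrite ck subrr normr0; lra.
by move=> k kN; rewrite (omega_limit_periodic_point q0 zper) -zorb; exact: rx.
Qed.

(** * Orbits that come close to a discontinuity *)

Lemma closure_orbit_f y z : X y -> Xt z -> closure (forward_orbit f y) z ->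
  closure (forward_orbit f y) (f z).
Proof.
move=> Xy tz /closureP cl; have [d d0 fz] := tspace_far tz.
apply/closureP => e e0; have m0 : 0 < Num.min d e by rewrite lt_min d0.
have [_ [m _ <-]] := cl _ m0; rewrite lt_min => /andP[md me].
exists (iter m.+1 f y); first by exists m.+1.
apply: le_lt_trans (far_cont d0 (tspace_space tz) fz (space_iter m Xy) md) _.
have /andP[l0 l1] := lam01; have := normr_ge0 (iter m f y - z); nra.
Qed.

Definition forward_invariant (A : set R) : Prop := forall z, Xt z -> A z -> A (f z).

(** Below the scale [eta], the points of [A] whose orbits avoid the discontinuities enter
    a side of a discontinuity only if the one-sided value there belongs to [A]. *)
Definition entry_scale (A : set R) (eta : R) : Prop := forall k s z,
  (0 < k < N)%N -> Xt z -> A z -> side k s eta z -> A (dval k s).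

(** If points of [A] entered a side at every scale, their images would be points of
    [A] converging to the one-sided value, and [A] is closed. *)
Lemma exists_entry_scale A : closed A -> forward_invariant A ->
  exists2 eta, 0 < eta & entry_scale A eta.
Proof.
move=> clA invA; have [e0 e00 He0] := side_piece.
have one s : exists (e : R) (n : nat), 0 < e /\ forall k, (k < N)%N -> (0 < k)%N ->
    forall z, Xt z -> A z -> side k s e z -> A (dval k s).
  apply: (@uniform_pos R (fun k e _ => (0 < k)%N ->
    forall z, Xt z -> A z -> side k s e z -> A (dval k s))).
    by move=> k e n e' n' h _ ee _ k0 z tz Az /(side_le ee); exact: h.
  move=> k kN.
  have [nA|An] := pselect (forall e, 0 < e -> exists z, [/\ Xt z, A z & side k s e z]);
      last first.
    have [e [e_gt0 He]] : exists e, 0 < e /\ ~ exists z, [/\ Xt z, A z & side k s e z].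
      apply: contrapT => H; apply: An => e e_gt0; apply: contrapT => H'.
      by apply: H; exists e.
    by exists e, 0%N; split => // _ z tz Az sz; case: He; exists z.
  exists 1, 0%N; split => // k0 _ _ _ _; apply: clA; apply/closureP => e e_gt0.
  have kN' : (0 < k < N)%N by rewrite k0.
  have m0 : 0 < Num.min e0 e by rewrite lt_min e00.
  have [z [tz Az sz]] := nA _ m0; exists (f z); first exact: invA.
  have pz : piece N c (germ_piece k s) z by apply: He0 kN' _ sz; rewrite ge_min lexx.
  apply: le_lt_trans (germ_dist kN' pz) _.
  have := side_dist sz; rewrite lt_min => /andP[_ me].
  have /andP[l0 l1] := lam01; have := normr_ge0 (z - c k); nra.
have [e1 [_ [e10 H1]]] := one true; have [e2 [_ [e20 H2]]] := one false.
exists (Num.min e1 e2); first by rewrite lt_min e10.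
move=> k s z /andP[k0 kN] tz Az; case: s => sz.
  by apply: (H1 k kN k0 z tz Az); apply: side_le sz; rewrite ge_min lexx.
by apply: (H2 k kN k0 z tz Az); apply: side_le sz; rewrite ge_min lexx orbT.
Qed.

(** When a discontinuity separates [u] from [x], the other end [v] lies on the side
    of [x] at a distance less than [eta], so the one-sided value belongs to [A]. *)
Lemma end_step_mem A eta x u v u' : forward_invariant A -> entry_scale A eta ->
  Xt u -> A u -> Xt v -> A v -> between u x v -> `|u - v| < eta ->
  end_step x u u' -> A u'.
Proof.
move=> invA etaA tu Au tv Av uxv uv [->|[k [s [kN -> h]]]]; first exact: invA.
apply: (etaA k s v) => //; move: uv; rewrite ltr_norml /side.
by case: s h => h uv; case: uxv; lra.
Qed.

(** The enclosure keeps its ends in [A] by [end_step_mem], and contraction makes its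
    length tend to zero. *)
Lemma omega_limit_sandwich A eta y u v : closed A -> forward_invariant A -> entry_scale A eta ->
  Xt y -> Xt u -> A u -> Xt v -> A v -> between u y v -> `|u - v| < eta ->
  omega_limit f y `<=` A.
Proof.
move=> clA invA etaA ty tu Au tv Av uyv uv.
have H t : exists u' v', [/\ Xt u' /\ A u', Xt v' /\ A v', between u' (iter t f y) v' &
    `|u' - v'| <= lam ^+ t * `|u - v|].
  elim: t => [|t [u' [v' [[tu' Au'] [tv' Av'] b h]]]].
    by exists u, v; rewrite expr0 mul1r.
  have uv' : `|u' - v'| < eta.
    apply: le_lt_trans h (le_lt_trans _ uv); apply: ler_piMl => //.
    by have /andP[] := lam_pow_le1 t.
  have tt := tspace_iter t ty.
  have [u2 [v2 [b2 h2 _ eu ev]]] :=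
    follow (tspace_space tt) (tspace_discont tt) tu' tv' b.
  exists u2, v2; split => //.
  - by split; [exact: end_step_tspace eu|exact: end_step_mem invA etaA _ _ _ _ b uv' eu].
  - split; first exact: end_step_tspace ev.
    by apply: end_step_mem invA etaA _ _ _ _ (between_sym b) _ ev; rewrite // distrC.
  - apply: le_trans h2 _; rewrite exprS -mulrA; apply: ler_wpM2l => //.
    by have /andP[/ltW] := lam01.
move=> z /omega_limitP yz; apply: clA; apply/closureP => e e0.
have e2 : 0 < e / 2 by rewrite divr_gt0.
have [n0 Hn0] := lam_small `|u - v| e2; have [m nm mz] := yz _ n0 e2.
have [u' [v' [[_ Au'] _ b h]]] := H m; exists u' => //.
have : `|u' - iter m f y| <= `|u' - v'|.
  case: b => b; first by rewrite !ler0_norm; lra.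
  by rewrite !ger0_norm; lra.
have := Hn0 m nm; have := ler_distD (iter m f y) u' z; lra.
Qed.

Lemma omega_limit_invariant A d : closed A -> forward_invariant A -> Xt d -> A d ->
  omega_limit f d `<=` A.
Proof.
move=> clA invA td Ad z /omega_limit_closure_orbit/closureP cl.
apply: clA; apply/closureP => e /cl[_ [n _ <-] h]; exists (iter n f d) => //.
by elim: n {h} => //= n; apply: invA; exact: tspace_iter.
Qed.

Lemma nosep_sub x y z : nosep x y -> between x z y -> nosep x z.
Proof.
by move=> nxy xzy k kN xkz; apply: (nxy k kN); case: xzy; case: xkz; rewrite /between; lra.
Qed.

(** A first visit of the orbit of [x] to the side [s] of [c k] is compared with the
    orbit of [dval k s], which stays in [A]. If no discontinuity ever separates
    the two, they are asymptotic. Otherwise consider the first separation, by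
    [c k2] at time [m]. A later and deeper visit to the same side arrives, after
    the same delay [m], between the companion [a m] and [c k2]; one step later it
    lies between two points of [A] less than [eta] apart. *)
Lemma omega_limit_capture A x k s : Xt x -> closed A -> forward_invariant A ->
  (0 < k < N)%N -> approaches x k s -> A (dval k s) -> omega_limit f x `<=` A.
Proof.
move=> tx clA invA kN xk Ad; have /andP[l0 l1] := lam01.
have [eta eta0 etaA] := exists_entry_scale clA invA.
have [e0 e00 He0] := side_piece.
have td := dval_tspace s kN; have gN := germ_piece_ok s kN.
have m0 : 0 < Num.min e0 eta by rewrite lt_min e00.
have [n _ sn] := xk _ 0%N m0.
have pn : piece N c (germ_piece k s) (iter n f x).
  by apply: He0 kN _ sn; rewrite ge_min lexx.
have dn : `|iter n f x - c k| < eta.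
  by have := side_dist sn; rewrite lt_min => /andP[].
have d1 : `|dval k s - iter n.+1 f x| <= lam * `|iter n f x - c k|.
  by rewrite distrC; exact: germ_dist.
have Xn1 : X (iter n.+1 f x) by exact/space_iter/tspace_space.
pose a j := iter j f (dval k s); pose b j := iter j f (iter n.+1 f x).
have [all|nall] := pselect (forall j, nosep (a j) (b j)).
  apply: subset_trans (omega_limit_invariant clA invA td Ad).
  apply: (@omega_limit_asymp _ _ _ _ n.+1 0%N) => e e_gt0.
  have [n0 H] := lam_small `|dval k s - iter n.+1 f x| e_gt0.
  exists n0 => j /H h; rewrite addn0 iterD distrC.
  have [h' _] := @nosep_iter _ _ j td Xn1 (fun i _ => all i).
  exact: le_lt_trans h' h.
have exm : exists m, ~~ `[< nosep (a m) (b m) >].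
  apply: contrapT => H; apply: nall => j; apply: contrapT => h.
  by apply: H; exists j; apply/asboolP.
case: (ex_minnP exm) => m /asboolP nm minm.
have before j : (j < m)%N -> nosep (a j) (b j).
  move=> jm; apply: contrapT => h; have : (m <= j)%N by apply: minm; apply/asboolP.
  by rewrite leqNgt jm.
have [k2 k2N ak2b] : exists2 k2, (0 < k2 < N)%N & between (a m) (c k2) (b m).
  apply: contrapT => h; apply: nm => k2 k2N bk; apply: h; by exists k2.
have abm : `|a m - b m| < eta.
  have [h _] := nosep_iter td Xn1 before; apply: le_lt_trans h _.
  have /andP[_ h1] := lam_pow_le1 m.
  have := normr_ge0 (dval k s - iter n.+1 f x).
  have : lam ^+ m * `|dval k s - iter n.+1 f x| <= `|dval k s - iter n.+1 f x|.
    exact: ler_piMl.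
  have : lam * `|iter n f x - c k| <= `|iter n f x - c k| by apply: ler_piMl => //; exact: ltW.
  lra.
(* The second visit is so deep that no discontinuity separates [y] from [a m]. *)
have tam : Xt (a m) by exact: tspace_iter.
have [d' d'0 fam] := tspace_far tam.
have nk : iter n f x <> c k by apply: tspace_neq => //; exact: tspace_iter.
have nk0 : 0 < `|iter n f x - c k| by rewrite normr_gt0 subr_eq0; apply/eqP.
have m1 : 0 < Num.min (Num.min e0 d') `|iter n f x - c k|.
  by rewrite !lt_min e00 d'0.
have [n' _ sn'] := xk _ 0%N m1.
have pn' : piece N c (germ_piece k s) (iter n' f x).
  by apply: He0 kN _ sn'; rewrite !ge_min lexx.
have := side_dist sn'; rewrite !lt_min => /andP[/andP[_ dn'] dnn].
have bt0 : between (c k) (iter n' f x) (iter n f x).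
  move: sn sn' dnn; rewrite /side /between; case: (s) => h1 h2.
    by rewrite !gtr0_norm; lra.
  by rewrite !ltr0_norm; lra.
have bt1 : between (dval k s) (iter n'.+1 f x) (iter n.+1 f x).
  rewrite /= -(branch_germ s kN) -(branchE gN pn) -(branchE gN pn').
  exact: branch_between.
pose y := iter m f (iter n'.+1 f x).
have btj j : (j <= m)%N -> between (a j) (iter j f (iter n'.+1 f x)) (b j).
  move=> jm; apply: (nosep_iter td Xn1 _).2 bt1 => i ij; apply: before.
  exact: leq_trans jm.
have Xn'1 : X (iter n'.+1 f x) by exact/space_iter/tspace_space.
have yam : `|y - a m| < d'.
  rewrite distrC.
  have [|h _] := @nosep_iter _ _ m td Xn'1.
    by move=> j jm; apply: nosep_sub (before j jm) (btj j (ltnW jm)).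
  apply: le_lt_trans h (le_lt_trans _ dn').
  have /andP[_ h1] := lam_pow_le1 m.
  have h2 : lam ^+ m * `|dval k s - iter n'.+1 f x| <= `|dval k s - iter n'.+1 f x|.
    exact: ler_piMl.
  have h3 : `|dval k s - iter n'.+1 f x| <= lam * `|iter n' f x - c k|.
    by rewrite distrC; exact: germ_dist.
  have : lam * `|iter n' f x - c k| <= `|iter n' f x - c k| by apply: ler_piMl => //; exact: ltW.
  lra.
have ak2 := fam k2 k2N.
have btm : between (a m) y (b m) by exact: btj.
have ayk : between (a m) y (c k2).
  move: ak2 yam; rewrite ltr_norml ler_normr.
  by case: btm; case: ak2b; rewrite /between; lra.
have ty : Xt y by apply: tspace_iter; exact: tspace_iter.
have [i iN [pa py]] := same_piece (tspace_space tam) (tspace_discont tam)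
  (tspace_space ty) (far_nosep fam yam).
have Xk2 : X (c k2).
  have h1 : (0 <= k2 <= N)%N by clear -k2N; lia.
  have h2 : (k2 <= N <= N)%N by clear -k2N; lia.
  by apply/spaceP; rewrite !c_le.
have ack : `|a m - c k2| < eta.
  apply: le_lt_trans abm; case: ak2b => h.
    by rewrite !ler0_norm; lra.
  by rewrite !ger0_norm; lra.
(* [c k3] is the end of the piece of [y] that faces [c k2]; it may differ from
   [c k2], but it lies between [y] and [c k2]. *)
have [pk2|[k3 [s3 [k3N E h3]]]] := branch_cut iN py Xk2.
  by case: (piece_discont iN pk2); exists k2.
have Am : A (a m) by rewrite /a; elim: (m) => //= j; apply: invA; exact: tspace_iter.
have Ak3 : A (dval k3 s3).
  apply: (etaA k3 s3 (a m)) => //; move: ack; rewrite ltr_norml /side.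
  by case: s3 h3 {E} => h3 h; case: ayk; lra.
(* One step further the enclosing points are [f (a m)] and [dval k3 s3]. *)
have := @omega_limit_sandwich A eta (f y) (f (a m)) (dval k3 s3) clA invA etaA.
have -> : omega_limit f (f y) = omega_limit f x.
  by rewrite -(omega_limit_iter f x (m + n'.+1).+1) /= iterD.
apply => //.
- exact: tspace_f.
- exact: tspace_f.
- exact: invA.
- exact: dval_tspace.
- by rewrite -E -(branchE iN pa) -(branchE iN py); exact: branch_between.
- rewrite -E -(branchE iN pa); apply: le_lt_trans (branch_lip _ _ iN) _.
  have : lam * `|a m - c k2| <= `|a m - c k2| by apply: ler_piMl => //; exact: ltW.
  lra.
Qed.

(** The limit set is captured by the closed invariant set on the right, and contains
    it because the one-sided value is a limit point of the orbit. *)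
Lemma omega_limit_germ x k s : Xt x -> (0 < k < N)%N -> approaches x k s ->
  omega_limit f x = closure (forward_orbit f (dval k s)).
Proof.
move=> tx kN xk; have td := dval_tspace s kN; have Xd := tspace_space td.
rewrite eqEsubset; split.
  apply: (omega_limit_capture tx _ _ kN xk).
  - exact: closed_closure.
  - by move=> z tz; exact: closure_orbit_f.
  - by apply: subset_closure; exists 0%N.
apply: closure_orbit_omega => //; first exact: tspace_space.
exact: approaches_dval.
Qed.

(** * Irregular limit sets are minimal and perfect *)

(** Both limit sets are the closure of the orbit of any one-sided value that the
    orbit of [dval k s] approaches. *)
Lemma omega_limit_dval x k s : Xt x -> (0 < k < N)%N -> approaches x k s ->
  omega_limit f (dval k s) = omega_limit f x.
Proof.
move=> tx kN xk; have td := dval_tspace s kN.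
have [k' [s' [k'N dk']]] := irregular_approaches td (approaches_irregular_dval tx kN xk).
rewrite (omega_limit_germ td k'N dk') (omega_limit_germ tx k'N (s := s')) //.
apply: approaches_trans dk' => //; first exact: tspace_space.
exact: approaches_dval.
Qed.

(** A point [y] of the limit set whose orbit avoids the discontinuities is irregular
    too, since otherwise it would absorb [x]. Whatever [y] approaches is approached by [x], so both limit sets
    are the closure of one and the same orbit. *)
Lemma omega_limit_minimal x : Xt x -> ~ regular x -> tminimal N c f (omega_limit f x).
Proof.
move=> tx rx; have Xx := tspace_space tx.
split=> [|y [xy ty]]; first exact: omega_limit_space.
rewrite eqEsubset; split; first exact: closure_orbit_omega.
have ry : ~ regular y.
  by move=> ry; apply: rx => k kN; rewrite (regular_attract ty Xx ry xy); exact: ry.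
have [k [s [kN yk]]] := irregular_approaches ty ry.
rewrite (omega_limit_germ tx kN (approaches_trans Xx ty xy yk)).
by rewrite -(omega_limit_germ ty kN yk); exact: omega_limit_closure_orbit.
Qed.

(** A finite orbit is its own limit set and contains no discontinuity. *)
Lemma irregular_aperiodic x m m' : Xt x -> ~ regular x -> (m < m')%N ->
  iter m f x <> iter m' f x.
Proof.
move=> tx rx mm E; apply: rx => k kN; rewrite -(omega_limit_iter f x m).
have q0 : (0 < m' - m)%N by rewrite subn_gt0.
rewrite (omega_limit_periodic_point q0); last by rewrite -iterD subnK // ltnW.
by move=> [j _]; apply: tspace_neq => //; do 2!apply: tspace_iter.
Qed.

(** The limit set is the limit set of one of its own points [dval k s], whose orbit
    never repeats; hence each of its points is approximated by two different
    points of that orbit. *)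
Lemma omega_limit_perfect x : Xt x -> ~ regular x -> perfect_set (omega_limit f x).
Proof.
move=> tx rx; have clo := @omega_limit_closed _ f x; split => //.
rewrite eqEsubset; split.
  exact: subset_trans (@subset_limit_point _ _) clo.
have [k [s [kN xk]]] := irregular_approaches tx rx.
have td := dval_tspace s kN; have rd := approaches_irregular_dval tx kN xk.
rewrite -(omega_limit_dval tx kN xk) => y /omega_limitP dy U /nbhs_ballP[e /= e0 eU].
have [m _ my] := dy e 0%N e0; have [m' mm' my'] := dy e m.+1 e0.
have mem j : omega_limit f (dval k s) (iter j f (dval k s)).
  rewrite (omega_limit_dval tx kN xk) (omega_limit_germ tx kN xk).
  by apply: subset_closure; exists j.
have inU j : `|iter j f (dval k s) - y| < e -> U (iter j f (dval k s)).
  by move=> h; apply: eU; rewrite -ball_normE /= distrC.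
have [E|/eqP nE] := pselect (iter m f (dval k s) = y); last first.
  by exists (iter m f (dval k s)); split => //; exact: inU.
exists (iter m' f (dval k s)); split => //; last exact: inU.
by apply/eqP; rewrite -E; apply/nesym/irregular_aperiodic.
Qed.

(** Otherwise, past some time and below some scale [eta], each discontinuity is
    visited from one side only. Two visits to the same side then stay unseparated
    for ever, because a separating discontinuity would be visited from both
    sides. The orbit is therefore asymptotic to a cycle, and its limit set is
    finite instead of perfect. *)
Lemma exists_two_sided x : Xt x -> ~ regular x ->
  exists2 k, (0 < k < N)%N & approaches x k true /\ approaches x k false.
Proof.
move=> tx rx; apply: contrapT => nex; have Xx := tspace_space tx.
have one s : exists (e : R) (n : nat), 0 < e /\ forall k, (k < N)%N ->
    ~ approaches x k s -> forall m, (n <= m)%N -> ~ side k s e (iter m f x).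
  apply: (@uniform_pos R (fun k e n => ~ approaches x k s ->
      forall m, (n <= m)%N -> ~ side k s e (iter m f x))).
    move=> k e n e' n' h _ ee nn na m nm /(side_le ee); apply: h => //.
    exact: leq_trans nm.
  move=> k kN; apply: contrapT => H; apply: (H); exists 1, 0%N; split => // na.
  exfalso; apply: na => e n e0; apply: contrapT => nm; apply: H.
  by exists e, n; split => // _ m mn sm; apply: nm; exists m.
have [e1 [n1 [e10 H1]]] := one true; have [e2 [n2 [e20 H2]]] := one false.
have [k [s [kN xk]]] := irregular_approaches tx rx.
have eta0 : 0 < Num.min e1 e2 by rewrite lt_min e10.
set eta := Num.min e1 e2 in eta0.
(* Two visits to the same side, hence closer than [eta] to each other. *)
have [n nn sn] := xk eta (n1 + n2)%N eta0.
have [m nm sm] := xk eta n.+1 eta0.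
have close : `|iter n f x - iter m f x| < eta.
  by move: sn sm; rewrite ltr_norml /side; case: (s); lra.
have tn := tspace_iter n tx; have Xm := space_iter m Xx.
have ns t : nosep (iter t f (iter n f x)) (iter t f (iter m f x)).
  elim/ltn_ind: t => t IH l lN bl.
  have [h _] := nosep_iter tn Xm IH.
  have {h} : `|iter t f (iter n f x) - iter t f (iter m f x)| < eta.
    apply: le_lt_trans h (le_lt_trans _ close); apply: ler_piMl => //.
    by have /andP[] := lam_pow_le1 t.
  have := tspace_neq (tspace_iter t tn) lN.
  have := tspace_neq (tspace_iter t (tspace_iter m tx)) lN.
  rewrite -!iterD in bl * => /eqP nem /eqP nen h.
  have far1 j : (n <= j)%N -> side l true eta (iter j f x) -> approaches x l true.
    move=> nj sj; apply: contrapT => /H1/(_ _ _ _) => /(_ _ j); apply => //.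
    - by case/andP: lN.
    - by clear -nn nj; lia.
    - by apply: side_le sj; rewrite /eta ge_min lexx.
  have far2 j : (n <= j)%N -> side l false eta (iter j f x) -> approaches x l false.
    move=> nj sj; apply: contrapT => /H2/(_ _ _ _) => /(_ _ j); apply => //.
    - by case/andP: lN.
    - by clear -nn nj; lia.
    - by apply: side_le sj; rewrite /eta ge_min lexx orbT.
  have jn : (n <= t + n)%N by exact: leq_addl.
  have jm : (n <= t + m)%N by clear -nm; lia.
  move: h; rewrite ltr_norml => h; apply: nex; exists l => //.
  case: bl => bl.
    split; [apply: far1 jm _|apply: far2 jn _]; rewrite /side.
      by move: nem; rewrite neq_lt; case/orP; lra.
    by move: nen; rewrite neq_lt; case/orP; lra.
  split; [apply: far1 jn _|apply: far2 jm _]; rewrite /side.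
    by move: nen; rewrite neq_lt; case/orP; lra.
  by move: nem; rewrite neq_lt; case/orP; lra.
pose w := iter n f x; pose q := (m - n)%N.
have q0 : (0 < q)%N by rewrite /q subn_gt0.
have wq : iter q f w = iter m f x by rewrite -iterD subnK // ltnW.
have near_per t : `|iter (t + q) f w - iter t f w| <= lam ^+ t * `|w - iter m f x|.
  have [h _] := @nosep_iter _ _ t tn Xm (fun j _ => ns j).
  by rewrite distrC iterD wq.
have [z [zq wz]] := @asymp_periodic R lam _ (fun t => iter t f w) q lam01 q0 near_per.
have omE := omega_limit_periodic q0 zq wz; rewrite omega_limit_iter in omE.
have xck := approaches_omega_c xk.
have [e e_gt0 He] := @finite_far R (fun r => z r != c k) z (c k) q (fun r _ => elimN eqP).
have [_ perf] := omega_limit_perfect tx rx.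
move: xck; rewrite -perf => /(_ _ (nbhsx_ballx (c k) e e_gt0))[y [yk]].
rewrite omE => -[r _ zr]; move: yk; rewrite -{y}zr (periodic_mod zq) => zk.
have := He _ (ltn_pmod r q0) zk.
by rewrite leNgt -ball_normE /= distrC => /negP.
Qed.

(** At a point where [f] is continuous either one-sided limit is the value of [f].
    At [c k] the limit from an approached side is a limit point of the orbit. *)
Lemma omega_limit_pseudo_invariant x : Xt x -> pseudo_invariant N c f (omega_limit f x).
Proof.
move=> tx; have Xx := tspace_space tx; split; first exact: omega_limit_space.
have /andP[l0 l1] := lam01.
move=> y xy; have Xy := omega_limit_space Xx xy; have /spaceP/andP[y0 yN] := Xy.
have [e0 e00 He0] := side_piece.
have lim_at F l : (forall e : R, 0 < e -> \forall z \near F, `|z - y| < e) ->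
    Filter F -> (\forall z \near F, `|f z - l| <= lam * `|z - y|) -> f z @[z --> F] --> l.
  move=> Fy FF Fl; apply/cvgrPdist_lt => e e_gt0.
  apply: filterS2 (Fy e e_gt0) Fl => z h1 h2; rewrite distrC.
  by have := normr_ge0 (z - y); nra.
have left_near e : 0 < e -> \forall z \near y^'-, `|z - y| < e.
  move=> e_gt0; near=> z; have zy : z < y by near: z; exact: nbhs_left_lt.
  have : y - e < z by near: z; apply: nbhs_left_gt; lra.
  by rewrite ltr_norml; lra.
have right_near e : 0 < e -> \forall z \near y^'+, `|z - y| < e.
  move=> e_gt0; near=> z; have zy : y < z by near: z; exact: nbhs_right_gt.
  have : z < y + e by near: z; apply: nbhs_right_lt; lra.
  by rewrite ltr_norml; lra.
have [[k /= kN ck]|ny] := pselect (Delta y).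
  rewrite -ck in xy *; have [s xk] := omega_c_approaches tx kN xy.
  have cl0 : c 0%N < c k by apply: c_lt; clear -kN; lia.
  have clN : c k < c N by apply: c_lt; clear -kN; lia.
  case: s xk => xk; [right|left]; split => //.
    exists (dval k true); first exact: approaches_dval.
    rewrite ck; apply: lim_at => //.
    near=> z; rewrite -ck; apply: germ_dist => //; apply: He0 (lexx _) _ => //.
    rewrite /side ck; apply/andP; split; first by near: z; exact: nbhs_right_gt.
    by near: z; apply: nbhs_right_lt; lra.
  exists (dval k false); first exact: approaches_dval.
  rewrite ck; apply: lim_at => //.
  near=> z; rewrite -ck; apply: germ_dist => //; apply: He0 (lexx _) _ => //.
  rewrite /side ck; apply/andP; split; last by near: z; exact: nbhs_left_lt.
  by near: z; apply: nbhs_left_gt; lra.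
have [d d0 fy] := discont_far ny; have xfy := omega_limit_f Xx ny xy.
have m0 := c_first_last.
have [yN'|yN'] := ltP y (c N).
  right; split => //; exists (f y) => //; apply: lim_at => //.
  near=> z; have zy : y < z by near: z; exact: nbhs_right_gt.
  have zN : z < c N by near: z; exact: nbhs_right_lt.
  apply: (far_cont d0 Xy fy); first by apply/spaceP; lra.
  by near: z; exact: right_near.
left; split; first by lra.
exists (f y) => //; apply: lim_at => //.
near=> z; have zy : z < y by near: z; exact: nbhs_left_lt.
have z0 : c 0%N < z by near: z; apply: nbhs_left_gt; lra.
apply: (far_cont d0 Xy fy); first by apply/spaceP; lra.
by near: z; exact: left_near.
Unshelve. all: by end_near. Qed.

(** * Periodic orbits attract one-sided values *)

Lemma follow_end x u : Xt x -> Xt u -> exists u',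
  `|u' - f x| <= lam * `|u - x| /\ end_step x u u'.
Proof.
move=> tx tu; have [i iN px] := tspace_piece tx; exists (branch i u).
by rewrite -(branchE iN px); split; [exact: branch_lip|exact: branch_end_step].
Qed.

(** Companions of the orbit of [z] are contracted towards it, and become closer to
    it than it is to the discontinuities. *)
Lemma periodic_attracts (E : set R) z : Xt z -> regular z -> E `<=` Xt ->
  (forall t, exists u, E u /\ `|u - iter t f z| <= lam ^+ t * (c N - c 0%N)) ->
  exists2 u, E u & omega_limit f z = omega_limit f u.
Proof.
move=> tz rz EX H; have [d d0 fz] := regular_far tz rz.
have [n0 Hn0] := lam_small (c N - c 0%N) d0.
have [u [Eu h]] := H n0; exists u => //.
rewrite -(omega_limit_iter f z n0); apply/esym.
apply: (@far_attract d _ _ 0%N) => //.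
- exact: tspace_iter.
- exact/tspace_space/EX.
- by move=> m; rewrite -iterD.
- exact: le_lt_trans h (Hn0 _ (leqnn _)).
Qed.

Lemma space_dist x y : X x -> X y -> `|x - y| <= c N - c 0%N.
Proof. by move=> /spaceP ? /spaceP ?; rewrite ler_norml; lra. Qed.

(** Follow the orbit of [z] by a companion that starts at an arbitrary one-sided
    value: at each time the companion is an iterate of some one-sided value. *)
Lemma regular_germ z : Xt z -> regular z ->
  exists k s, (0 < k < N)%N /\ omega_limit f z = omega_limit f (dval k s).
Proof.
move=> tz rz; have k1 : (0 < 1 < N)%N := N_ge2.
pose E := [set u | exists k s n, (0 < k < N)%N /\ u = iter n f (dval k s)].
have EX : E `<=` Xt.
  by move=> _ [k [s [n [kN ->]]]]; apply: tspace_iter; exact: dval_tspace.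
have [t|_ [k [s [n [kN ->]]]] zu] := @periodic_attracts E z tz rz EX; last first.
  by exists k, s; rewrite zu omega_limit_iter.
elim: t => [|t [u [Eu h]]].
  exists (dval 1 true); split; first by exists 1%N, true, 0%N.
  by rewrite expr0 mul1r; apply: space_dist; apply: tspace_space => //; exact: dval_tspace.
have [u' [h' eu]] := follow_end (tspace_iter t tz) (EX _ Eu); exists u'; split.
  case: eu => [->|[k [s [kN -> _]]]]; last by exists k, s, 0%N.
  by case: Eu => k [s [n [kN ->]]]; exists k, s, n.+1.
apply: le_trans h' _; rewrite exprS -mulrA; apply: ler_wpM2l => //.
by have /andP[/ltW] := lam01.
Qed.

Definition increasing_pieces : Prop := forall i, (0 < i <= N)%N ->
  {in piece N c i &, {homo f : x y / x < y}}.

Lemma branch_homo i u v : increasing_pieces -> (0 < i <= N)%N -> u <= v ->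
  branch i u <= branch i v.
Proof.
move=> inc iN uv; have c12 := c_pred_lt iN.
have /andP[u1 u2] := clamp_in u iN; have /andP[v1 v2] := clamp_in v iN.
have := clamp_le (ltW c12) uv; rewrite -(branch_clamp u iN) -(branch_clamp v iN) le_eqVlt => /predU1P[-> //|lt].
have := @ext_mono i 1 iN (normr1 _) _ _ _ u1 lt v2.
rewrite !mul1r => h; apply/ltW; rewrite /branch !(clampK _ (ltW c12)); apply: h => x y px py xy; rewrite !mul1r.
exact: (inc _ iN _ _ (mem_set px) (mem_set py)).
Qed.

(** Increasing branches keep the companion that starts at [c 0] to the left of the
    orbit of [z], so it is only ever replaced by right-hand values. *)
Lemma regular_left_germ z : increasing_pieces -> Xt z -> regular z ->
  omega_limit f z = omega_limit f (d_first N c f) \/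
  exists2 k, (0 < k < N)%N & omega_limit f z = omega_limit f (d_plus N c f k).
Proof.
move=> inc tz rz.
pose P u := u = c 0%N \/ exists2 k, (0 < k < N)%N & u = dval k true.
have PX u : P u -> Xt u.
  by case=> [->|[k kN ->]]; [exact: tspace_first|exact: dval_tspace].
pose E := [set u | exists2 n, exists2 v, P v & u = iter n f v & True].
have EX : E `<=` Xt by move=> _ [n [v /PX tv ->] _]; exact: tspace_iter.
have H t : exists u, [/\ E u, u <= iter t f z & `|u - iter t f z| <= lam ^+ t * (c N - c 0%N)].
  elim: t => [|t [u [Eu uz h]]].
    have /spaceP/andP[z0 _] := tspace_space tz.
    exists (c 0%N); split => //; first by exists 0%N => //; exists (c 0%N) => //; left.
    by rewrite expr0 mul1r; apply: space_dist; apply: tspace_space => //; exact: tspace_first.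
  have [i iN pz] := tspace_piece (tspace_iter t tz); exists (branch i u); split.
  - case: (branch_end_step iN pz (EX _ Eu)) => [->|[k [s [kN ->]]]].
      by case: Eu => n [v Pv ->] _; exists n.+1 => //; exists v.
    case: s => uk; last by lra.
    by exists 0%N => //; exists (dval k true) => //; right; exists k.
  - by rewrite /= -(branchE iN pz); exact: branch_homo.
  - rewrite /= -(branchE iN pz); apply: le_trans (branch_lip _ _ iN) _.
    rewrite exprS -mulrA; apply: ler_wpM2l => //.
    by have /andP[/ltW] := lam01.
have [t|_ [n [v Pv ->] _] zu] := @periodic_attracts E z tz rz EX.
  by have [u [Eu _ h]] := H t; exists u.
rewrite zu omega_limit_iter; case: Pv => [->|[k kN ->]]; last by right; exists k.
by left; rewrite -f_first -(omega_limit_iter f (c 0%N) 1).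
Qed.

(** * Limit sets contain no segment *)

Lemma omega_limit_step x n : Xt x -> omega_limit f x `<=` attractor_step N c f n.
Proof.
move=> tx.
have mem m : (n <= m)%N -> attractor_step N c f n (iter m f x).
  elim: n m => [|n IH] m nm; first exact/tspace_space/tspace_iter.
  case: m nm => // m nm; apply: subset_closure; exists (iter m f x) => //.
  by split; [exact: IH|exact/tspace_discont/tspace_iter].
have clo : closed (attractor_step N c f n).
  case: (n) => [|n']; first exact: space_closed.
  by rewrite /attractor_step iterS; exact: closed_closure.
move=> y /omega_limitP xy; apply: clo; apply/closureP => e e0.
by have [m nm my] := xy e n e0; exists (iter m f x) => //; exact: mem.
Qed.

(** Segments spanned by the images of the parts of the segment [p] in the
    successive pieces. *)
Definition split_piece p : seq (R * R) :=
  [seq (Num.min (branch i p.1) (branch i p.2), Num.max (branch i p.1) (branch i p.2))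
  | i <- index_iota 1 N.+1].

Lemma split_piece_mem p i x : (0 < i <= N)%N -> piece N c i x ->
  p.1 <= x <= p.2 -> cover (split_piece p) (f x).
Proof.
move=> iN px xp; apply/coverP; exists (Num.min (branch i p.1) (branch i p.2),
  Num.max (branch i p.1) (branch i p.2)).
  by apply/mapP; exists i => //; rewrite mem_index_iota ltnS.
have := @branch_between i p.1 x p.2 iN (or_introl xp).
rewrite (branchE iN px) /= ge_min le_max.
by case=> /andP[-> ->]; rewrite ?orbT.
Qed.

Lemma clamp_sum u v n : (n <= N)%N ->
  \sum_(1 <= i < n.+1) (clamp (c i.-1) (c i) v - clamp (c i.-1) (c i) u) =
  clamp (c 0%N) (c n) v - clamp (c 0%N) (c n) u.
Proof.
elim: n => [|n IH] nN.
  have e w : clamp (c 0%N) (c 0%N) w = c 0%N.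
    by case: (clampP w (lexx (c 0%N))) => -[h ->] //; lra.
  by rewrite big_geq // !e subrr.
have h1 : c 0%N <= c n by apply: c_le; rewrite leq0n ltnW.
have h2 := c_incr nN.
rewrite big_nat_recr //= IH; last exact: ltnW.
have E w : clamp (c 0%N) (c n) w + clamp (c n) (c n.+1) w = clamp (c 0%N) (c n.+1) w + c n.
  case: (clampP w h1) => -[a ->]; case: (clampP w (ltW h2)) => -[b ->];
  case: (clampP w (le_trans h1 (ltW h2))) => -[d ->]; lra.
have := E u; have := E v; lra.
Qed.

(** The pieces cut a segment into parts whose lengths add up to at most its own,
    and each part is contracted. *)
Lemma split_piece_length p : p.1 <= p.2 ->
  total_length (split_piece p) <= lam * (p.2 - p.1).
Proof.
move=> p12; have /andP[l0 l1] := lam01.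
rewrite /total_length /split_piece big_map.
apply: (@le_trans _ _ (\sum_(1 <= i < N.+1)
    lam * (clamp (c i.-1) (c i) p.2 - clamp (c i.-1) (c i) p.1))).
  rewrite !big_nat; apply: ler_sum => i; rewrite ltnS => iN /=.
  have := branch_lip (clamp (c i.-1) (c i) p.2) (clamp (c i.-1) (c i) p.1) iN.
  rewrite !branch_clamp //.
  have /ltW ci := c_pred_lt iN.
  have /ger0_norm -> : 0 <= clamp (c i.-1) (c i) p.2 - clamp (c i.-1) (c i) p.1.
    by rewrite subr_ge0; exact: clamp_le.
  by rewrite max_sub_min.
rewrite -mulr_sumr clamp_sum //; apply: ler_wpM2l; first exact: ltW.
have cN : c 0%N <= c N by apply: c_le; rewrite leq0n leqnn.
by case: (clampP p.1 cN) => -[h ->]; case: (clampP p.2 cN) => -[h' ->]; lra.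
Qed.

Lemma attractor_step_space n : attractor_step N c f n `<=` X.
Proof.
elim: n => // n IH y; rewrite /attractor_step iterS => /closureP cl.
apply: space_closed; apply/closureP => e /cl[_ [z [zn _] <-] h].
by exists (f z) => //; apply/f_space/IH.
Qed.

Lemma attractor_step_cover n : exists s : seq (R * R),
  [/\ forall p, p \in s -> p.1 <= p.2, attractor_step N c f n `<=` cover s &
      total_length s <= lam ^+ n * (c N - c 0%N)].
Proof.
have /andP[l0 l1] := lam01.
elim: n => [|n [s [ps sub len]]].
  exists [:: (c 0%N, c N)]; split.
  - by move=> p; rewrite inE => /eqP -> /=; apply: c_le; rewrite leq0n leqnn.
  - by move=> x /spaceP xX; apply/coverP; exists (c 0%N, c N); rewrite ?mem_head.
  - by rewrite /total_length big_seq1 expr0 mul1r.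
exists (flatten [seq split_piece p | p <- s]); split.
- by move=> q /flattenP[_ /mapP[p _ ->] /mapP[i _ ->]] /=; rewrite ge_min le_max lexx.
- rewrite /attractor_step iterS; apply: (@subset_trans _
      (closure (cover (flatten [seq split_piece p | p <- s])))).
    apply: closureS => _ [z [zn nz] <-].
    have [i iN pz] := exists_piece (attractor_step_space zn) nz.
    have /coverP[p pin zp] := sub _ zn.
    have /coverP[q qin fq] := split_piece_mem iN pz zp.
    by apply/coverP; exists q => //; apply/flattenP; exists (split_piece p) => //; exact: map_f.
  exact: cover_closed.
- rewrite exprS -mulrA; apply: (@le_trans _ _ (lam * total_length s)); last first.
    by apply: ler_wpM2l => //; exact: ltW.
  elim: s ps {sub len} => [|p s IH] ps /=; first by rewrite /total_length !big_nil mulr0.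
  rewrite /total_length big_cat big_cons mulrDr; apply: lerD.
    by apply/split_piece_length/ps; rewrite mem_head.
  by apply: IH => q qs; apply: ps; rewrite inE qs orbT.
Qed.

(** A nontrivial component would contain a segment, which is covered at each time
    [n] by segments of total length at most a multiple of the [n]-th power of the
    contraction rate. *)
Lemma omega_limit_cantor x : Xt x -> ~ regular x -> cantor_set (omega_limit f x).
Proof.
move=> tx rx; have Xx := tspace_space tx; split.
- exact: omega_limit_nonempty.
- apply: (subclosed_compact (@omega_limit_closed _ f x) (@segment_compact R (c 0%N) (c N))).
  exact: omega_limit_space.
- exact: omega_limit_perfect.
- move=> y xy; rewrite eqEsubset; split=> [z Cz|_ ->]; last exact: connected_component_refl.
  apply: contrapT => zy.
  have itvC : is_interval (connected_component (omega_limit f x) y).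
    by apply/connected_intervalP; exact: component_connected.
  have Cy : connected_component (omega_limit f x) y y by exact: connected_component_refl.
  have nosegment a b : connected_component (omega_limit f x) y a ->
      connected_component (omega_limit f x) y b -> a < b -> False.
    move=> Ca Cb ab; have ab0 : 0 < b - a by rewrite subr_gt0.
    have [n Hn] := lam_small (c N - c 0%N) ab0.
    have [s [ps sub len]] := attractor_step_cover n.
    have := Hn n (leqnn _); apply/negP; rewrite -leNgt; apply: le_trans len.
    apply: cover_segment => // w; rewrite /= in_itv /= => wab.
    apply: sub; apply: (omega_limit_step n tx).
    exact: (connected_component_sub (itvC _ _ Ca Cb _ wab)).
  have /eqP := zy; rewrite neq_lt => /orP[h|h]; exact: nosegment h.
Qed.

(** * Gaps at a discontinuity *)

(** A side of [c k] that is not approached contains a small interval free of limit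
    points with [c k] as an end point; the gap that contains this interval has
    [c k] in its boundary. *)
Lemma gap_boundary x k s : Xt x -> (0 < k < N)%N -> omega_limit f x (c k) ->
  ~ approaches x k s ->
  exists2 G, gap N c (omega_limit f x) G & boundary G (c k).
Proof.
move=> tx kN xk nap; have [e0 e00 He0] := side_piece.
have [e [n [e_gt0 He]]] : exists e n, 0 < e /\ forall m, (n <= m)%N ->
    ~ side k s e (iter m f x).
  apply: contrapT => H; apply: nap => e n e_gt0; apply: contrapT => H'; apply: H.
  by exists e, n; split => // m nm sm; apply: H'; exists m.
pose a := Num.min e0 e; have a0 : 0 < a by rewrite lt_min e00.
have ae : a <= e by rewrite ge_min lexx orbT.
have ae0 : a <= e0 by rewrite ge_min lexx.
have sub : [set y | side k s a y] `<=` X `\` omega_limit f x.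
  move=> y sy; split.
    by apply: piece_space (germ_piece_ok s kN) _; exact: He0 sy.
  by move=> xy; have [m nm] := omega_limit_side n xy (side_le ae sy); exact: He.
pose p (t : R) := if s then c k + t else c k - t.
have ps t : 0 < t < a -> side k s a (p t) by rewrite /side /p; case: (s); lra.
have pa : side k s a (p (a / 2)) by apply: ps; lra.
exists (connected_component (X `\` omega_limit f x) (p (a / 2))).
  by exists (p (a / 2)) => //; exact: sub.
have conn : [set y | side k s a y] `<=`
    connected_component (X `\` omega_limit f x) (p (a / 2)).
  apply: connected_component_max => //; apply/connected_intervalP => u v.
  by rewrite /side /=; case: (s) => hu hv w hw; lra.
split.
  apply/closureP => d d0; pose t := Num.min (a / 2) (d / 2).
  have t0 : 0 < t by rewrite lt_min !divr_gt0.
  have ta : t <= a / 2 by rewrite ge_min lexx.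
  have td : t <= d / 2 by rewrite ge_min lexx orbT.
  exists (p t); first by apply/conn/ps; lra.
  by rewrite /p ltr_norml; case: (s); lra.
by move=> /interior_subset/connected_component_sub[].
Qed.

(** * The attractor is a union of limit sets *)

Lemma attractor_step_approx n y e : attractor_step N c f n y -> 0 < e ->
  exists x, [/\ X x, forall j, (j < n)%N -> ~ Delta (iter j f x) &
    `|iter n f x - y| < e].
Proof.
elim: n y e => [|n IH] y e; first by move=> Xy e0; exists y; rewrite subrr normr0.
rewrite /attractor_step iterS => /closureP cl e0.
have e2 : 0 < e / 2 by rewrite divr_gt0.
have [_ [z [zn nz] <-] zy] := cl _ e2.
have [d d0 fz] := discont_far nz; have Xz := attractor_step_space zn.
have m0 : 0 < Num.min d (e / 2) by rewrite lt_min d0.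
have [x [Xx nx]] := IH z _ zn m0; rewrite lt_min => /andP[xd xe].
have [i iN [pz px]] := same_piece Xz nz (space_iter n Xx) (far_nosep fz xd).
exists x; split => //.
  move=> j; rewrite ltnS leq_eqVlt => /predU1P[->|]; last exact: nx.
  exact: piece_discont iN px.
have := f_lipP iN px pz; have := ler_distD (f z) (iter n.+1 f x) y.
have /andP[l0 l1] := lam01; have := normr_ge0 (iter n f x - z).
have : lam * `|iter n f x - z| <= `|iter n f x - z| by apply: ler_piMl => //; exact: ltW.
rewrite /=; lra.
Qed.

(** Starting points of the companions: the one-sided values, and the end points of
    the space, whose first images are the two remaining points of [dset]. *)
Definition ends : seq R := [:: c 0%N; c N] ++
  [seq dval k true | k <- iota 1 N.-1] ++ [seq dval k false | k <- iota 1 N.-1].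

Lemma mem_discont_index k : (k \in iota 1 N.-1) = (0 < k < N)%N.
Proof. by rewrite mem_iota; case: (N) N_ge2. Qed.

Lemma mem_ends k s : (0 < k < N)%N -> dval k s \in ends.
Proof.
move=> kN; rewrite !mem_cat; case: s; apply/orP; right; apply/orP; [left|right];
  by apply/mapP; exists k => //; rewrite mem_discont_index.
Qed.

Lemma ends_tspace d : d \in ends -> Xt d.
Proof.
rewrite !mem_cat !inE => /orP[/orP[/eqP->|/eqP->]|].
- exact: tspace_first.
- exact: tspace_last.
by case/orP => /mapP[k]; rewrite mem_discont_index => kN ->; exact: dval_tspace.
Qed.

Lemma ends_dset d : d \in ends -> exists2 d', dset N c f d' &
  omega_limit f d = omega_limit f d'.
Proof.
rewrite !mem_cat !inE => /orP[/orP[/eqP->|/eqP->]|].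
- exists (d_first N c f); first by left; left; left.
  by rewrite -f_first -(omega_limit_iter f (c 0%N) 1).
- exists (d_last N c f); first by left; left; right.
  by rewrite -f_last -(omega_limit_iter f (c N) 1).
case/orP => /mapP[k]; rewrite mem_discont_index => kN ->.
  by exists (dval k true) => //; right; exists k.
by exists (dval k false) => //; left; right; exists k.
Qed.

(** The interval spanned by [u] and [v] is the closed image of a monotonicity
    interval of the [n]-th iterate; its ends are distinct points of orbits that
    start in [ends]. *)
Lemma follow_iter x n : X x -> (forall j, (j < n)%N -> ~ Delta (iter j f x)) ->
  exists u v, [/\ between u (iter n f x) v, `|u - v| <= lam ^+ n * (c N - c 0%N), u <> v,
    exists2 d, d \in ends & exists m, u = iter m f d &
    exists2 d, d \in ends & exists m, v = iter m f d].
Proof.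
move=> Xx; elim: n => [|n IH] nx.
  exists (c 0%N), (c N); have c0N := c_first_last.
  have /spaceP xX := Xx; split.
  - by left.
  - by rewrite expr0 mul1r distrC ger0_norm // subr_ge0 ltW.
  - lra.
  - by exists (c 0%N); [rewrite /ends inE eqxx|exists 0%N].
  - by exists (c N); [rewrite /ends !inE eqxx orbT|exists 0%N].
have [u [v [b h uv [d ed [m um]] [d' ed' [m' vm]]]]] := IH (fun j jn => nx j (ltnW jn)).
have tu : Xt u by rewrite um; apply/tspace_iter/ends_tspace.
have tv : Xt v by rewrite vm; apply/tspace_iter/ends_tspace.
have [u' [v' [b' h' uv' eu ev]]] := follow (space_iter n Xx) (nx n (ltnSn n)) tu tv b.
exists u', v'; split => //.
- apply: le_trans h' _; rewrite exprS -mulrA; apply: ler_wpM2l => //.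
  by have /andP[/ltW] := lam01.
- exact: uv'.
- case: eu => [->|[k [s [kN -> _]]]]; first by exists d => //; exists m.+1; rewrite um.
  by exists (dval k s); [exact: mem_ends|exists 0%N].
- case: ev => [->|[k [s [kN -> _]]]]; first by exists d' => //; exists m'.+1; rewrite vm.
  by exists (dval k s); [exact: mem_ends|exists 0%N].
Qed.

(** The ends [u] and [v] of the enclosure are distinct and arbitrarily close. Finitely
    many points have a positive minimal distance, so one of the two is a late
    iterate of a starting point. *)
Lemma attractor_near_end y M e : attractor N c f y -> 0 < e ->
  exists2 d, d \in ends & exists2 m, (M <= m)%N & `|iter m f d - y| < e.
Proof.
move=> ay e0.
pose S := [seq iter m f d | m <- iota 0 M, d <- ends].
have memS u : (exists2 d, d \in ends & exists m, u = iter m f d) ->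
    u \in S \/ exists2 d, d \in ends & exists2 m, (M <= m)%N & u = iter m f d.
  move=> [d ed [m ->]]; case: (ltnP m M) => mM; last by right; exists d => //; exists m.
  by left; apply/allpairsP; exists (m, d); rewrite mem_iota.
(* [S] collects the early iterates; enclosures shorter than [rho] cannot have
   both ends in it. *)
have [rho rho0 Hrho] := seq_separation S.
have m0 : 0 < Num.min rho (e / 2) by rewrite lt_min rho0 divr_gt0.
have [n0 Hn0] := lam_small (c N - c 0%N) m0; pose n := n0.+1.
have e2 : 0 < e / 2 by rewrite divr_gt0.
have [x [Xx nx xy]] := attractor_step_approx (ay n isT) e2.
have [u [v [b h uv eu ev]]] := follow_iter Xx nx.
have {h}: `|u - v| < Num.min rho (e / 2) by apply: le_lt_trans h (Hn0 n _); exact: leqW.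
rewrite lt_min => /andP[h1 h2].
have near w : `|w - iter n f x| <= `|u - v| -> `|w - y| < e.
  by have := ler_distD (iter n f x) w y; lra.
have hu : `|u - iter n f x| <= `|u - v|.
  by case: b => b; [rewrite !ler0_norm|rewrite !ger0_norm]; lra.
have hv : `|v - iter n f x| <= `|u - v|.
  by case: b => b; [rewrite ger0_norm ?ler0_norm|rewrite ler0_norm ?ger0_norm]; lra.
have [uS|[d ed [m Mm uE]]] := memS u eu; last first.
  by exists d => //; exists m => //; rewrite -uE; exact: near.
have [vS|[d ed [m Mm vE]]] := memS v ev; last first.
  by exists d => //; exists m => //; rewrite -vE; exact: near.
by have := Hrho u v uS vS uv; lra.
Qed.

(** Arbitrarily late iterates of finitely many starting points come close to [y],
    hence those of one of them do. *)
Lemma attractor_sub y : attractor N c f y ->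
  exists2 d, dset N c f d & omega_limit f d y.
Proof.
move=> ay; suff [d ed dy] : exists2 d, d \in ends & omega_limit f d y.
  by have [d' Dd' E] := ends_dset ed; exists d'; rewrite -?E.
apply: contrapT => nex.
case: (@uniform_pos R (fun k e n => forall m, (n <= m)%N ->
    e <= `|iter m f (nth 0 ends k) - y|) (size ends)).
- move=> k e n e' n' h _ ee nn m nm; apply: le_trans ee (h m _).
  exact: leq_trans nm.
- move=> k ks; apply: contrapT => H; apply: nex; exists (nth 0 ends k); first exact: mem_nth.
  apply/omega_limitP => e n e0; apply: contrapT => H'; apply: H; exists e, n; split => // m nm.
  by rewrite leNgt; apply/negP => h; apply: H'; exists m.
move=> e [n [e0 He]]; have [d ed [m nm]] := attractor_near_end n ay e0.
have := He (index d ends); rewrite index_mem ed => /(_ isT m nm).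
by rewrite nth_index //; lra.
Qed.

(** * The finite family of limit sets *)

Definition germs : seq (nat * bool) :=
  [seq (k, s) | k <- iota 1 N.-1, s <- [:: true; false]].

Lemma mem_germs k s : ((k, s) \in germs) = (0 < k < N)%N.
Proof.
rewrite -mem_discont_index; apply/allpairsP/idP => [[[k' s'] [/= h _ [-> _]]] //|h].
by exists (k, s); split => //=; case: (s).
Qed.

Definition limit_sets : seq (set R) :=
  undup [seq omega_limit f (dval g.1 g.2) | g <- germs].

Lemma limit_setsP M : M \in limit_sets <->
  exists k s, (0 < k < N)%N /\ M = omega_limit f (dval k s).
Proof.
rewrite mem_undup; split=> [/mapP[[k s]]|[k [s [kN ->]]]].
  by rewrite mem_germs => kN ->; exists k, s.
by apply/mapP; exists (k, s); rewrite ?mem_germs.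
Qed.

Lemma omega_limit_mem x : Xt x -> omega_limit f x \in limit_sets.
Proof.
move=> tx; apply/limit_setsP; have [rx|rx] := pselect (regular x).
  by have [k [s [kN xk]]] := regular_germ tx rx; exists k, s.
have [k [s [kN xk]]] := irregular_approaches tx rx; exists k, s; split => //.
by rewrite (omega_limit_dval tx kN xk).
Qed.

Definition avoids_discont (M : set R) : bool :=
  `[< forall k, (0 < k < N)%N -> ~ M (c k) >].

Lemma limit_set_periodic M : M \in limit_sets -> avoids_discont M ->
  periodic_orbit N c f M /\ M `<=` Xt.
Proof.
move=> /limit_setsP[k [s [kN ->]]] /asboolP rd; have td := dval_tspace s kN.
have [z [q [tz q0 zq _ ->]]] := regular_periodic td rd; split.
  by exists z; split; [exact: tspace_space|exists q|].
by move=> _ [n _ <-]; exact: tspace_iter.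
Qed.

Lemma limit_set_irregular M : M \in limit_sets -> ~~ avoids_discont M ->
  exists x, [/\ Xt x, ~ regular x & M = omega_limit f x].
Proof.
move=> /limit_setsP[k [s [kN ->]]] /asboolPn rd.
by exists (dval k s); split => //; exact: dval_tspace.
Qed.

Lemma attractorE : attractor N c f = \bigcup_(M in [set` limit_sets]) M.
Proof.
rewrite eqEsubset; split => y.
  move=> /attractor_sub[d dD dy]; exists (omega_limit f d) => //.
  exact/omega_limit_mem/D_sub.
move=> [M /limit_setsP[k [s [kN ->]]] dy] n _.
exact: omega_limit_step (dval_tspace s kN) _ dy.
Qed.

(** The limit sets are those of the one-sided values, all of which lie in [dset]. *)
Lemma size_limit_sets_dset :
  (0 < size limit_sets <= #|` fset_set (dset N c f)|)%N.
Proof.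
have finI : finite_set [set k | (0 < k < N)%N].
  by apply: sub_finite_set (finite_II N) => k /andP[].
have finD : finite_set (dset N c f).
  rewrite /dset !finite_setU; split; last exact: finite_image.
  by split; [split; exact: finite_set1|exact: finite_image].
apply/andP; split.
  have h1 : (0 < 1 < N)%N := N_ge2.
  by have := omega_limit_mem (dval_tspace true h1); case: limit_sets.
pose ds := undup [seq dval g.1 g.2 | g <- germs].
apply: (@leq_trans (size ds)).
  rewrite /limit_sets map_comp; apply: leq_trans (_ : size (map (omega_limit f) ds) <= _)%N.
    apply: uniq_leq_size; first exact: undup_uniq.
    by move=> M; rewrite mem_undup => /mapP[d dg ->]; apply/map_f; rewrite mem_undup.
  by rewrite size_map.
apply: uniq_leq_size; first exact: undup_uniq.
move=> d; rewrite mem_undup in_fset_set // inE => /mapP[[k s]].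
rewrite mem_germs => kN ->; case: s; [right|left; right]; by exists k.
Qed.

(** Among the [2 * (N - 1)] one-sided values, an irregular limit set is attained at
    both values of a discontinuity approached from both sides. *)
Lemma size_limit_sets_weighted :
  (size (seq.filter avoids_discont limit_sets) +
   2 * size (seq.filter (predC avoids_discont) limit_sets) <= 2 * (N - 1))%N.
Proof.
have sz : size [seq omega_limit f (dval g.1 g.2) | g <- germs] = (2 * (N - 1))%N.
  by rewrite size_map size_allpairs size_iota /= subn1 mulnC.
rewrite -sz; apply: size_undup_weighted => M Ms aM.
have Ms' : M \in limit_sets by rewrite mem_undup.
have [x [tx rx ->]] := limit_set_irregular Ms' aM.
have [k kN [xk1 xk2]] := exists_two_sided tx rx.
rewrite count_map -size_filter -/(size [:: (k, true); (k, false)]).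
apply: uniq_leq_size => [|g]; first by rewrite /= inE xpair_eqE andbF.
rewrite !inE => /orP[] /eqP ->;
  by rewrite mem_filter mem_germs kN andbT; apply/eqP; exact: (omega_limit_dval tx kN).
Qed.

(** Every limit set is attained at the value of [c 0] or at a right-hand value: for
    regular points by following from the left, for irregular ones at a
    discontinuity approached from both sides. *)
Lemma size_limit_sets_increasing : increasing_pieces -> (size limit_sets <= N)%N.
Proof.
move=> inc.
pose t := omega_limit f (d_first N c f) ::
  [seq omega_limit f (d_plus N c f k) | k <- iota 1 N.-1].
have sz : size t = N by rewrite /= size_map size_iota (prednK (ltnW N_ge2)).
rewrite -[leqRHS]sz.
apply: uniq_leq_size; first exact: undup_uniq.
have plus k : (0 < k < N)%N -> omega_limit f (d_plus N c f k) \in t.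
  move=> kN; rewrite inE; apply/orP; right; apply/mapP.
  by exists k; rewrite ?mem_discont_index.
move=> M /limit_setsP[k [s [kN ->]]]; have td := dval_tspace s kN.
have [rd|rd] := pselect (regular (dval k s)).
  have [->|[j jN ->]] := regular_left_germ inc td rd; first by rewrite mem_head.
  exact: plus.
have [j jN [xj _]] := exists_two_sided td rd.
by rewrite -(omega_limit_dval td jN xj); exact: plus.
Qed.

End Pcim.

(** * The decomposition *)

Theorem theorem1p3 (R : realType) (N : nat) (c : nat -> R) (f : R -> R)
    (f_pcim : pcim N c f)
    (f_inj : forall i, (0 < i <= N)%N -> set_inj (piece N c i) f)
    (D_sub : dset N c f `<=` tspace N c f) :
  exists (N1 N2 : nat) (O : 'I_N1 -> set R) (K : 'I_N2 -> set R),
    (injective O /\ injective K) /\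
    ((forall i, periodic_orbit N c f (O i) /\ O i `<=` tspace N c f) /\
     (forall j, [/\ cantor_set (K j), tminimal N c f (K j) &
                    pseudo_invariant N c f (K j)]) /\
     attractor N c f = (\bigcup_i O i) `|` (\bigcup_j K j)) /\
    (forall x, tspace N c f x ->
       (exists i, omega_limit f x = O i) \/
       (exists j, omega_limit f x = K j)) /\
    ((1 <= N2)%N -> forall j, exists k,
       [/\ (1 <= k <= N - 1)%N, K j (c k),
           K j = closure (forward_orbit f (d_plus N c f k)) &
           K j = closure (forward_orbit f (d_minus N c f k))]) /\
    ((1 <= N2)%N -> forall j k, (1 <= k <= N - 1)%N -> K j (c k) ->
       (K j = closure (forward_orbit f (d_plus N c f k)) \/
        K j = closure (forward_orbit f (d_minus N c f k))) /\
       (~ (exists2 G, gap N c (K j) G & boundary G (c k)) ->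
        closure (forward_orbit f (d_plus N c f k)) =
        closure (forward_orbit f (d_minus N c f k)))) /\
    ((1 <= N1 + N2 <= #|` fset_set (dset N c f)|)%N /\
     (N1 + 2 * N2 <= 2 * (N - 1))%N /\
     ((forall i, (0 < i <= N)%N ->
         {in piece N c i &, {homo f : x y / x < y}}) ->
      (N1 + N2 <= N)%N)).
Proof.
pose L := limit_sets N c f; pose P := avoids_discont N c.
pose sO := seq.filter P L; pose sK := seq.filter (predC P) L.
have uL : uniq L by exact: undup_uniq.
have memO M : M \in sO -> M \in L /\ P M by rewrite mem_filter => /andP[].
have memK M : M \in sK -> exists x, [/\ tspace N c f x, ~ regular N c f x & M = omega_limit f x].
  rewrite mem_filter => /andP[nP ML].
  exact: (limit_set_irregular f_pcim D_sub ML nP).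
have sizeL : (size sO + size sK)%N = size L by rewrite !size_filter count_predC.
pose O (i : 'I_(size sO)) := nth set0 sO i; pose K (j : 'I_(size sK)) := nth set0 sK j.
have OP i : O i \in sO by exact: mem_nth.
have KP j : K j \in sK by exact: mem_nth.
have inO M : M \in sO -> exists i, M = O i.
  move=> MO; have iM : (index M sO < size sO)%N by rewrite index_mem.
  by exists (Ordinal iM); rewrite /O nth_index.
have inK M : M \in sK -> exists j, M = K j.
  move=> MK; have iM : (index M sK < size sK)%N by rewrite index_mem.
  by exists (Ordinal iM); rewrite /K nth_index.
have inL M : M \in L -> (exists i, M = O i) \/ (exists j, M = K j).
  by move=> ML; case PM : (P M); [left; apply: inO|right; apply: inK];
    rewrite mem_filter /= PM.
have LM M : (exists i, M = O i) \/ (exists j, M = K j) -> M \in L.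
  by move=> [[i ->]|[j ->]]; [have := OP i|have := KP j]; rewrite mem_filter => /andP[].
have kN k : (1 <= k <= N - 1)%N = (0 < k < N)%N by case: f_pcim => + _ _ _; clear; lia.
exists (size sO), (size sK), O, K; split; [|split; [|split; [|split; [|split]]]].
- split=> i j /eqP; rewrite nth_uniq ?filter_uniq // => /eqP; exact: val_inj.
- split; [|split].
  + by move=> i; have [OL PO] := memO _ (OP i);
      exact: (limit_set_periodic f_pcim f_inj D_sub OL PO).
  + move=> j; have [x [tx rx ->]] := memK _ (KP j); split.
    * exact: (omega_limit_cantor f_pcim f_inj D_sub tx rx).
    * exact: (omega_limit_minimal f_pcim f_inj D_sub tx rx).
    * exact: (omega_limit_pseudo_invariant f_pcim tx).
  + rewrite (attractorE f_pcim f_inj D_sub) eqEsubset; split => y.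
      move=> [M /inL[[i ->]|[j ->]] My]; [left; by exists i|right; by exists j].
    by move=> [[i _ Oy]|[j _ Ky]]; [exists (O i)|exists (K j)] => //;
      apply: LM; [left; exists i|right; exists j].
- move=> x tx; apply: inL; exact: (omega_limit_mem f_pcim f_inj D_sub tx).
- move=> _ j; have [x [tx rx ->]] := memK _ (KP j).
  have [k k0 [xk1 xk2]] := exists_two_sided f_pcim f_inj D_sub tx rx.
  exists k; rewrite kN; split => //.
  + exact: approaches_omega_c xk1.
  + exact: (omega_limit_germ f_pcim f_inj D_sub tx k0 xk1).
  + exact: (omega_limit_germ f_pcim f_inj D_sub tx k0 xk2).
- move=> _ j k; rewrite kN => k0; have [x [tx rx ->]] := memK _ (KP j) => xk; split.
    have [s xs] := omega_c_approaches tx k0 xk.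
    by case: s xs => /(omega_limit_germ f_pcim f_inj D_sub tx k0) ->; [left|right].
  move=> ngap; have both s : approaches c f x k s.
    apply: contrapT => ns; apply: ngap.
    exact: (gap_boundary f_pcim tx k0 xk ns).
  rewrite -(omega_limit_germ f_pcim f_inj D_sub tx k0 (both true)).
  exact: (omega_limit_germ f_pcim f_inj D_sub tx k0 (both false)).
- rewrite sizeL; split; first exact: (size_limit_sets_dset f_pcim f_inj D_sub).
  split; first exact: (size_limit_sets_weighted f_pcim f_inj D_sub).
  exact: (size_limit_sets_increasing f_pcim f_inj D_sub).
Qed.
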